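(* Let $(n_j)_{j\in\mathbb{N}}$ be a sequence of natural numbers and let $\Phi=(\Phi_N)_{N\in\mathbb{N}}$ be a Følner sequence in $\mathbb{N}$. The following are equivalent: (1) For all invertible measure preserving systems $(X,\mathcal{B},\mu,T)$ and all $f\in L^2(\mu)$, the limit $\lim_{N\to\infty}\mathbb{E}_{n\in\mathrm{IP}_{\Phi_N}((n_j)_{j\in\mathbb{N}})}T^nf$ exists in $L^2(\mu)$. (2) The limit $\lim_{N\to\infty}\mathbb{E}_{n\in\mathrm{IP}_{\Phi_N}((n_j)_{j\in\mathbb{N}})}\alpha^n$ exists for all $\alpha\in\mathcal{S}^1$. Furthermore, the following are equivalent: (3) For all invertible measure preserving systems $(X,\mathcal{B},\mu,T)$ and all $f\in L^2(\mu)$, the averages $\mathbb{E}_{n\in\mathrm{IP}_{\Phi_N}((n_j)_{j\in\mathbb{N}})}T^nf$ converge in $L^2(\mu)$ as $N\to\infty$ to the orthogonal projection of $f$ onto the space of $T$-invariant functions. (4) $\lim_{N\to\infty}\mathbb{E}_{n\in\mathrm{IP}_{\Phi_N}((n_j)_{j\in\mathbb{N}})}\alpha^n=\delta_1(\alpha)$ for all $\alpha\in\mathcal{S}^1$.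
   Context: $\mathbb{N}=\{1,2,3,\dots\}$; $\mathcal{S}^1$ is the unit circle in $\mathbb{C}$; $\delta_1(\alpha)=1$ if $\alpha=1$ and $\delta_1(\alpha)=0$ otherwise. An invertible measure preserving system $(X,\mathcal{B},\mu,T)$ consists of a probability space and an invertible measurable measure preserving $T:X\to X$; throughout, $X$ is a compact metric space, $\mathcal{B}$ its Borel $\sigma$-algebra and $\mu$ a regular measure. $T$ also denotes the unitary operator $f\mapsto f\circ T$ on $L^2(\mu)$. A Følner sequence in $\mathbb{N}$ is a sequence of finite sets $\Phi_N\subseteq\mathbb{N}$ with $\lim_{N\to\infty}|(a+\Phi_N)\Delta\Phi_N|/|\Phi_N|=0$ for all $a\in\mathbb{N}$. For finite $F\subseteq\mathbb{N}$ put $n_F=\sum_{j\in F}n_j$ ($n_\emptyset=0$). $\mathrm{IP}_{\Phi_N}((n_j)_{j\in\mathbb{N}})$ is the multiset $\{n_F:F\subseteq\Phi_N\}$, and averages over it count multiplicity: $\mathbb{E}_{n\in\mathrm{IP}_{\Phi_N}((n_j)_{j\in\mathbb{N}})}a_n=2^{-|\Phi_N|}\sum_{F\subseteq\Phi_N}a_{n_F}$. *)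

(* Defs.v *)
From HB Require Import structures.
From mathcomp Require Import all_boot all_order all_algebra finmap complex.
From mathcomp Require Import all_classical all_reals all_analysis.

Set Implicit Arguments.
Unset Strict Implicit.
Unset Printing Implicit Defensive.
Import Order.TTheory GRing.Theory Num.Theory.
Import numFieldNormedType.Exports.

Local Open Scope classical_set_scope.
Local Open Scope ring_scope.

(* The positive integers are rendered inside [nat]: finite sets of indices are
   required not to contain 0, and values at the index 0 are never constrained. *)

(* The nonemptiness of the sets, implicit in the quotient, is made explicit
   because x / 0 = 0 here. *)
Definition folner (R : realType) (Phi : nat -> {fset nat}) : Prop :=
  (forall N, (0 < N)%N -> Phi N != fset0%fset /\ 0%N \notin Phi N) /\
  (forall a, (0 < a)%N ->
     (fun N : nat =>
        let S := [fset (a + j)%N | j in Phi N]%fset in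
        #|` ((S `\` Phi N) `|` (Phi N `\` S))%fset|%:R / #|` Phi N|%:R : R)
       @ \oo --> (0 : R)).

(* Summing over the subsets of A, rather than over the values n_F, counts
   multiplicities. *)
Definition ip_avg (R : realType) (n : nat -> nat) (A : {fset nat})
    (a : nat -> R[i]) : R[i] :=
  (2 ^+ #|` A|)^-1 * \sum_(F <- fpowerset A) a (\sum_(j <- F) n j)%N.

(* The library builds sigma-algebras on pointed types only. This excludes just
   the empty space, which carries no probability measure. *)
#[short(type="pmetricType")]
HB.structure Definition PointedMetric (R : numDomainType) :=
  {M of Metric R M & isPointed M}.

Definition borel (R : realType) (X : pmetricType R) :=
  g_sigma_algebraType (@open X).

Section systems.
Context {R : realType} {X : pmetricType R}.
Variable mu : probability (borel X) R.

Definition regular_measure : Prop :=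
  forall B : set (borel X), measurable B ->
    mu B = ereal_inf [set mu U | U in [set U : set X | open U /\ B `<=` U]] /\
    mu B = ereal_sup [set mu K | K in [set K : set X | compact K /\ K `<=` B]].

Definition measure_preserving (T : borel X -> borel X) : Prop :=
  measurable_fun [set: borel X] T /\
  forall B : set (borel X), measurable B -> mu (T @^-1` B) = mu B.

Definition invertible_mps (T : borel X -> borel X) : Prop :=
  [/\ compact [set: X], regular_measure, measure_preserving T &
      exists S : borel X -> borel X,
        [/\ cancel T S, cancel S T & measurable_fun [set: borel X] S]].

Implicit Types f g h : X -> R[i].

(* [`|z|] lives in [R[i]]; its real part is the modulus as an element of R. *)
Definition L2norm f : \bar R :=
  'N[mu]_2%:E[(fun x : borel X => (complex.Re `|f x|)%:E)].

Definition L2 f : Prop :=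
  [/\ measurable_fun [set: borel X] (fun x => complex.Re (f x)),
      measurable_fun [set: borel X] (fun x => complex.Im (f x)) &
      (L2norm f < +oo)%E].

Definition L2_cvg (F : nat -> X -> R[i]) g : Prop :=
  (fun N => L2norm (fun x => F N x - g x)) @ \oo --> 0%E.

Definition L2_inner f g : R[i] :=
  ((\int[mu]_x complex.Re (f x * (g x)^*)%R) +i*
   (\int[mu]_x complex.Im (f x * (g x)^*)%R))%C.

Definition L2_invariant (T : X -> X) g : Prop :=
  L2 g /\ {ae mu, forall x, g (T x) = g x}.

(* g represents the orthogonal projection of f onto the T-invariant functions *)
Definition invariant_projection (T : X -> X) f g : Prop :=
  L2_invariant T g /\
  forall h, L2_invariant T h -> L2_inner (fun x => f x - g x) h = 0.

End systems.

(* Main.v *)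
Require Import Defs.
From HB Require Import structures.
From mathcomp Require Import all_boot all_order all_algebra finmap complex.
From mathcomp Require Import all_classical all_reals all_analysis.
From mathcomp Require Import measurable_realfun.
From mathcomp Require Import zify ring lra.

(* For a real u in L^2 the correlations <T^j u, T^l u> form a positive
   semidefinite Toeplitz kernel, so they equal L (cos (2 pi (j - l) t)) for a
   positive functional L on the continuous functions on [0, 1].  Hence
   ||\sum_m c_m T^m u||^2 = L (|\sum_m c_m e^(2 pi i m t)|^2), and a bounded
   convergence theorem for L turns pointwise convergence of the exponential
   averages into convergence of the averages of T^m u in L^2.  The limit is
   invariant when the exponential averages tend to 0 off alpha = 1, because
   then (X - 1) p_N tends to 0 at every point of the circle.  Conversely, the
   rotation by t has the eigenfunction e^(2 pi i x), so that L^2 convergence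
   of its averages forces convergence of the averages of cis t ^+ m. *)

Set Implicit Arguments.
Unset Strict Implicit.
Unset Printing Implicit Defensive.
Import Order.TTheory GRing.Theory Num.Theory.
Import numFieldNormedType.Exports.

Local Open Scope classical_set_scope.
Local Open Scope ring_scope.

(** * Positive functionals *)

(** No spectral measure is built: L is constrained on continuous functions only, and the pointwise
    limit of the exponential averages p_N need not be continuous. Hence the limit in L^2 comes from
    the Cauchy property: along pairs (N, M) with both indices tending to infinity, p_N - p_M tends
    to 0 at every point, its squared modulus is continuous and at most 4, and L of it tends to 0;
    completeness of L^2 then supplies the limit. The bound holds because p_N has nonnegative
    coefficients of sum 1. The same sum makes <p_N(T) u, h> constant in N for invariant h, which
    identifies the limit as a projection. The coefficients being real, f is treated through its real
    and imaginary parts; the correlation kernel of a real function is symmetric, so cosines suffice.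
    In the converse direction, the coefficient of the limit g along the unit eigenfunction is the
    limit of the averages of alpha ^+ m. If g is invariant and alpha differs from 1, then g is
    orthogonal to the eigenfunction and that coefficient is 0. *)

Section positive_functionals.
Context {R : realType} {X : topologicalType}.
Variables (K : set X) (L : (X -> R) -> R).

(** [L] is total, but nothing is asked of it outside the continuous functions. Testing positivity on
    [K] alone makes [L f] depend only on the restriction of a continuous f to [K]. *)
Definition positive_functional :=
  (forall (a : R) (f g : X -> R), continuous f -> continuous g ->
     L (fun x => a * f x + g x) = a * L f + L g) /\
  (forall f : X -> R, continuous f -> (forall x, K x -> 0 <= f x) -> 0 <= L f).

Hypothesis Lpos : positive_functional.
Local Notation one := (cst 1 : X -> R).

Lemma cst_continuousT (c : R) : continuous (fun _ : X => c).
Proof. by move=> x; exact: cvg_cst. Qed.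

Lemma continuous_combT (a : R) (f g : X -> R) :
  continuous f -> continuous g -> continuous (fun x => a * f x + g x).
Proof. by move=> cf cg x; exact: continuousD (continuousM (cvg_cst _) (cf x)) (cg x). Qed.

Lemma functional_le (f g : X -> R) : continuous f -> continuous g ->
  (forall x, K x -> f x <= g x) -> L f <= L g.
Proof.
move=> cf cg fg; rewrite -subr_ge0.
have -> : L g - L f = L (fun x => -1 * f x + g x) by rewrite Lpos.1 //; lra.
apply: Lpos.2; first exact: continuous_combT.
by move=> x Kx; have := fg x Kx; lra.
Qed.

Lemma functionalZ (a : R) (f : X -> R) : continuous f -> L (fun x => a * f x) = a * L f.
Proof.
move=> cf; have L0 : L (fun=> 0) = 0.
  have := Lpos.1 (-1) (fun=> 0) (fun=> 0) (@cst_continuousT 0) (@cst_continuousT 0).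
  by under eq_fun do rewrite mulr0 addr0; lra.
have := Lpos.1 a f (fun=> 0) cf (@cst_continuousT 0).
by under eq_fun do rewrite addr0; rewrite L0 addr0.
Qed.

Lemma functionalD (f g : X -> R) : continuous f -> continuous g ->
  L (fun x => f x + g x) = L f + L g.
Proof.
move=> cf cg; rewrite -[L f]mul1r -Lpos.1//.
by under [in RHS]eq_fun do rewrite mul1r.
Qed.

Lemma functional_cst c : L (fun=> c) = c * L one.
Proof.
rewrite -functionalZ; last exact: cst_continuousT.
by under [in RHS]eq_fun do rewrite mulr1.
Qed.

(** Apply [L] to |y| <= y^2 / (2 a) + a / 2. This replaces the Cauchy-Schwarz inequality without
    square roots of values of [L]. *)
Lemma functional_normr_le (f : X -> R) (a : R) : 0 < a -> continuous f ->
  L (fun x => f x ^+ 2) <= a ^+ 2 -> L (fun x => `|f x|) <= a * (1 + L one) / 2.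
Proof.
move=> a0 cf Lf.
have cf2 : continuous (fun x => f x ^+ 2) by move=> x; exact: continuousM (cf x) (cf x).
have cfn : continuous (fun x => `|f x|) by move=> x; exact: cvg_norm (cf x).
have : L (fun x => `|f x|) <= L (fun x => (2 * a)^-1 * f x ^+ 2 + a / 2).
  apply: functional_le => //.
    by apply: continuous_combT => //; exact: cst_continuousT.
  move=> x _; rewrite -[f x ^+ 2]real_normK ?num_real//.
  set y := `|f x|; have -> : (2 * a)^-1 * y ^+ 2 + a / 2 = y + (2 * a)^-1 * (y - a) ^+ 2.
    by field; lra.
  by rewrite lerDl mulr_ge0 ?sqr_ge0// invr_ge0; lra.
rewrite Lpos.1//; last exact: cst_continuousT.
rewrite functional_cst => /le_trans; apply.
have : (2 * a)^-1 * L (fun x => f x ^+ 2) <= (2 * a)^-1 * a ^+ 2.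
  by rewrite ler_wpM2l// invr_ge0; lra.
have -> : (2 * a)^-1 * a ^+ 2 = a / 2 by field; lra.
lra.
Qed.

Lemma functional_parallelogram (f g : X -> R) : continuous f -> continuous g ->
  L (fun x => (f x - g x) ^+ 2) =
  2 * L (fun x => f x ^+ 2) + 2 * L (fun x => g x ^+ 2)
  - 4 * L (fun x => ((f x + g x) / 2) ^+ 2).
Proof.
move=> cf cg.
have c2 (h : X -> R) : continuous h -> continuous (fun x => h x ^+ 2).
  by move=> ch x; exact: continuousM (ch x) (ch x).
have ch : continuous (fun x => (f x + g x) / 2).
  by move=> x; exact: continuousM (continuousD (cf x) (cg x)) (cvg_cst _).
have -> : (fun x => (f x - g x) ^+ 2) =
  (fun x => 2 * f x ^+ 2 + (2 * g x ^+ 2 + (- 4) * ((f x + g x) / 2) ^+ 2)).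
  by apply/funext => x; field.
rewrite Lpos.1; first rewrite Lpos.1; first rewrite functionalZ; rewrite ?mulNr ?addrA//; try exact: c2.
  by move=> x; exact: continuousM (cvg_cst _) (c2 _ _ x).
by apply: continuous_combT; [exact: c2|move=> x; exact: continuousM (cvg_cst _) (c2 _ _ x)].
Qed.

(** Compactness enters in its near-covering form: continuity spreads [G r x < d] to a neighbourhood
    of x, and monotonicity spreads it to all later indices, which is the local condition required at
    each point. *)
Lemma dini (G : nat -> X -> R) (d : R) : compact K -> (forall r, continuous (G r)) ->
  (forall r x, G r.+1 x <= G r x) -> (forall x, K x -> exists r, G r x < d) ->
  exists r, forall x, K x -> G r x < d.
Proof.
move=> /compact_near_coveringP + cG decG Gd.
have Gle r s x : (r <= s)%N -> G s x <= G r x.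
  elim: s => [|s IH]; first by rewrite leqn0 => /eqP ->.
  by rewrite leq_eqVlt => /orP[/eqP <-//|/IH]; exact: le_trans.
move=> /(_ nat \oo (fun r x => G r x < d) _)[].
  move=> x /Gd[r Gr].
  have /= := cG r x _ (lt_nbhsl Gr) => H.
  exists ([set y | G r y < d], [set s | (r <= s)%N]) => /=.
    by split => //; exists r.
  by move=> [y s] /= [Gy rs]; apply: le_lt_trans Gy; exact: Gle.
by move=> r _ /(_ r (leqnn _)) H; exists r => x Kx; exact: H.
Qed.

Lemma continuous_sumT (I : Type) (r : seq I) (F : I -> X -> R) :
  (forall i, continuous (F i)) -> continuous (fun x => \sum_(i <- r) F i x).
Proof.
move=> cF; elim: r => [|i r IH].
  by under eq_fun do rewrite big_nil; exact: cst_continuousT.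
under eq_fun do rewrite big_cons.
by move=> x; exact: continuousD (cF i x) (IH x).
Qed.

Lemma functional_sum (I : Type) (r : seq I) (F : I -> X -> R) :
  (forall i, continuous (F i)) ->
  L (fun x => \sum_(i <- r) F i x) = \sum_(i <- r) L (F i).
Proof.
move=> cF; elim: r => [|i r IH].
  rewrite big_nil; under eq_fun do rewrite big_nil.
  by rewrite functional_cst mul0r.
rewrite big_cons -IH -functionalD//; last exact: continuous_sumT.
by under eq_fun do rewrite big_cons.
Qed.

Section bounded_convergence.
Variables (C : R) (h : nat -> X -> R).
Hypotheses (cK : compact K) (ch : forall k, continuous (h k)).
Hypotheses (h_ge0 : forall k x, K x -> 0 <= h k x).
Hypotheses (h_le : forall k x, K x -> h k x <= C).

(** The last clause says that g is at most the supremum of the [h k] with k >= N on [K], phrased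
    through upper bounds c. The resulting set is convex and decreases with N, and stands for the
    convex hull of the tail of [h]. *)
Let tail e N (g : X -> R) := [/\ continuous g, (forall x, K x -> 0 <= g x),
  e <= L g & forall x c, K x -> (forall k, (N <= k)%N -> h k x <= c) -> g x <= c].

Let tailS e N M g : (N <= M)%N -> tail e M g -> tail e N g.
Proof.
move=> NM [cg g0 eg gh]; split => // x c Kx hc; apply: gh => // k Mk.
by apply: hc; exact: leq_trans Mk.
Qed.

Let tail_half e N f g : tail e N f -> tail e N g ->
  tail e N (fun x => (f x + g x) / 2).
Proof.
move=> [cf f0 ef fh] [cg g0 eg gh]; split.
- by move=> x; exact: continuousM (continuousD (cf x) (cg x)) (cvg_cst _).
- by move=> x Kx; have := f0 x Kx; have := g0 x Kx; lra.
- have -> : L (fun x => (f x + g x) / 2) = 2^-1 * (L f + L g).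
    rewrite -functionalD// -functionalZ; last first.
      by move=> x; exact: continuousD (cf x) (cg x).
    by under eq_fun do rewrite mulrC.
  lra.
- by move=> x c Kx hc; have := fh x c Kx hc; have := gh x c Kx hc; lra.
Qed.

(* Uniform convexity of [g |-> L (g ^ 2)] on the decreasing convex sets
   [tail e N]: near-minimizers are close to each other. *)
Let near_minimizers e (ne : forall N, exists g, tail e N g) (a : nat -> R) :
  (forall j, 0 < a j) -> (forall j, a j.+1 <= a j) ->
  exists g : nat -> X -> R, (forall j, tail e j (g j)) /\
    forall j, L (fun x => (g j x - g j.+1 x) ^+ 2) <= a j.
Proof.
move=> a0 aS.
(* [sup E] is the limit over N of the infimum of L (g ^ 2) on [tail e N]; these infima increase with
   N and are bounded because 0 <= g <= C on [K]. *)
pose E := [set c | exists N, forall g, tail e N g -> c <= L (fun x => g x ^+ 2)].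
have c2 (g : X -> R) : continuous g -> continuous (fun x => g x ^+ 2).
  by move=> cg x; exact: continuousM (cg x) (cg x).
have E0 : E 0.
  exists 0%N => g [cg _ _ _]; apply: Lpos.2; first exact: c2.
  by move=> x _; exact: sqr_ge0.
have ubE : ubound E (L (fun=> C ^+ 2)).
  move=> c [N Nc]; have [g gN] := ne N; apply: (le_trans (Nc _ gN)).
  case: gN => [cg g0 _ gh]; apply: functional_le; [exact: c2|exact: cst_continuousT|].
  move=> x Kx; rewrite ler_sqr ?nnegrE//.
  - by apply: gh => // k _; exact: h_le.
  - exact: g0.
  - exact: le_trans (h_ge0 0 Kx) (h_le 0 Kx).
have supE : has_sup E by split; [exists 0|exists (L (fun=> C ^+ 2))].
have /choice[N NP] : forall j, exists N, forall g, tail e N g ->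
    sup E - a j / 8 <= L (fun x => g x ^+ 2).
  move=> j; have [||c [N Nc] cj] := @sup_adherent _ E (a j / 8) => //.
    by rewrite divr_gt0.
  by exists N => g gN; apply: le_trans (Nc _ gN); exact: ltW.
(* [M] is nondecreasing and dominates both j and [N j]. *)
pose M j := (j + \sum_(i < j.+1) N i)%N.
have MS j : (M j <= M j.+1)%N.
  by rewrite /M [X in (_ <= _ + X)%N]big_ord_recr/= leq_add// leq_addr.
have NM j : (N j <= M j)%N.
  by rewrite /M big_ord_recr/= addnA leq_addl.
have /choice[g gP] : forall j, exists g, tail e (M j) g /\
    L (fun x => g x ^+ 2) <= sup E + a j / 8.
  move=> j; apply: contrapT => noj.
  have : sup E + a j / 8 <= sup E.
    apply: sup_upper_bound => //; exists (M j) => g gj; rewrite leNgt.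
    by apply/negP => /ltW ?; apply: noj; exists g.
  by have := a0 j; lra.
exists g; split => j.
  by apply: tailS (gP j).1; rewrite /M leq_addr.
have [gj Lj] := gP j; have [gj1 Lj1] := gP j.+1.
have gj1' := tailS (MS j) gj1.
(* The midpoint still lies in [tail e (N j)], so its square has L at least sup E - a j / 8. The
   parallelogram identity then bounds the distance by (2 + 2 + 4) a j / 8 = a j, whence the
   eighths. *)
have := NP j _ (tailS (NM j) (tail_half gj gj1')).
rewrite functional_parallelogram; [|by case: gj|by case: gj1].
have := aS j; lra.
Qed.

(* If [L (h k) >= e] infinitely often, pick [g j] in [tail e j] so close to each
   other that [L (min (g 0) .. (g r)) >= e / 2] for all r; these minima decrease
   to 0 pointwise, hence uniformly by Dini, a contradiction (Eberlein). *)
Theorem functional_bounded_convergence :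
  (forall x, K x -> h ^~ x @ \oo --> 0) -> (fun k => L (h k)) @ \oo --> 0.
Proof.
move=> h_cvg0; apply/cvgrPdist_lt => e e0; near_simpl.
suff [N Ne] : exists N, forall k, (N <= k)%N -> L (h k) < e.
  exists N => // k /= Nk; rewrite sub0r normrN ger0_norm ?Ne//.
  by apply: Lpos.2 => // x; exact: h_ge0.
apply: contrapT => noN.
have ne N : exists g, tail e N g.
  apply: contrapT => notail; apply: noN; exists N => k Nk.
  rewrite ltNge; apply/negP => ek; apply: notail; exists (h k); split => //.
  - by move=> x; exact: h_ge0.
  - by move=> x c Kx; exact.
have L1 : 0 <= L one by apply: Lpos.2 => //; exact: cst_continuousT.
(* Chosen so that b j (1 + L 1) / 2 = (e / 4) 2^-j, with sum e / 2 over j. The summand 1 keeps the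
   denominator positive when L 1 = 0. *)
pose b j : R := e / (2 * (1 + L one)) * 2^-1 ^+ j.
have b0 j : 0 < b j.
  by rewrite mulr_gt0 ?divr_gt0 ?exprn_gt0// ?mulr_gt0//; lra.
have [||g [gtail gclose]] := near_minimizers ne (a := fun j => b j ^+ 2).
- by move=> j; rewrite exprn_gt0.
- move=> j; rewrite ler_sqr ?nnegrE ?(ltW (b0 _))//.
  by rewrite [leLHS]/b exprS mulrCA -/(b j) ler_piMl ?(ltW (b0 _))//; lra.
have cg j : continuous (g j) by case: (gtail j).
have absg j : L (fun x => `|g j x - g j.+1 x|) <= e / 4 * 2^-1 ^+ j.
  have := @functional_normr_le (fun x => g j x - g j.+1 x) _ (b0 j) _ (gclose j).
  have -> : b j * (1 + L one) / 2 = e / 4 * 2^-1 ^+ j by rewrite /b; field; lra.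
  by apply; move=> x; exact: continuousB (cg _ x) (cg _ x).
pose G := fix G r := if r is r'.+1 then (fun x => Num.min (G r' x) (g r x)) else g 0.
(* [D r] is the accumulated variation of g 0, .., g r. Each of these functions is at least g 0 - D
   r, hence so is their minimum [G r], and L (D r) < e / 2. *)
pose D := fix D r := if r is r'.+1
  then (fun x => `|g r' x - g r x| + D r' x) else (fun=> 0 : R).
have cG r : continuous (G r).
  elim: r => [|r IH] /=; first exact: cg.
  by move=> x; exact: continuous_min (IH x) (cg _ x).
have cabs j : continuous (fun x => `|g j x - g j.+1 x|).
  by move=> x; exact: cvg_norm (continuousB (cg _ x) (cg _ x)).
have cD r : continuous (D r).
  elim: r => [|r IH] /=; first exact: cst_continuousT.
  by move=> x; exact: continuousD (cabs _ x) (IH x).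
have D_ge r x : g 0 x - D r x <= g r x /\ g 0 x - D r x <= G r x.
  elim: r => [|r [IHg IHG]] /=; first by rewrite subr0.
  have [? ?] : g r x - g r.+1 x <= `|g r x - g r.+1 x| /\ 0 <= `|g r x - g r.+1 x|.
    by rewrite ler_norm normr_ge0.
  by rewrite le_min; split; [|apply/andP; split]; lra.
have LD r : L (D r) <= e / 2 * (1 - 2^-1 ^+ r).
  elim: r => [|r IH] /=.
    by rewrite functional_cst expr0 subrr mulr0 mul0r.
  by rewrite functionalD//; have := absg r; rewrite exprS; lra.
have LG r : e / 2 <= L (G r).
  have : L (g 0) <= L (fun x => G r x + D r x).
    apply: functional_le => // [|x _]; first by move=> x; exact: continuousD (cG _ x) (cD _ x).
    by have := (D_ge r x).2; lra.
  rewrite functionalD//; have := LD r; case: (gtail 0) => _ _ eg _.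
  have : 0 <= e / 2 * 2^-1 ^+ r by rewrite mulr_ge0 ?exprn_ge0//; lra.
  by rewrite mulrBr mulr1; lra.
have Gg r x : G r x <= g r x by case: r => //= r; rewrite ge_min lexx orbT.
(* With this d, G r < d on [K] gives L (G r) <= d L 1 = e / 4 - d, below the lower bound e / 2. *)
pose d := e / (4 * (1 + L one)).
have d0 : 0 < d by rewrite divr_gt0//; lra.
have [r Gr] : exists r, forall x, K x -> G r x < d.
  apply: dini => // [r x|x Kx] /=; first by rewrite ge_min lexx.
  have /cvgrPdist_lt/(_ (d / 2) ltac:(lra))[N _ NP] := h_cvg0 x Kx.
  exists N; apply: le_lt_trans (Gg _ _) _.
  have : g N x <= d / 2.
    case: (gtail N) => _ _ _; apply => // k /NP /=.
    by rewrite sub0r normrN => /ltW; exact: le_trans (ler_norm _).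
  lra.
have : L (G r) <= d * L one.
  rewrite -functional_cst; apply: functional_le => //; first exact: cst_continuousT.
  by move=> x /Gr/ltW.
have -> : d * L one = e / 4 - d by rewrite /d; field; lra.
by have := LG r; lra.
Qed.

End bounded_convergence.

End positive_functionals.

(** Compactness of [-B, B] gives a cluster point p. If the preimage of a neighbourhood V of p were
    not in the ultrafilter, that of the complement of V would be, against clustering at p. *)
Lemma ultra_bounded_cvg (R : realType) (U : set_system nat) (u : nat -> R) (B : R) :
  UltraFilter U -> (\forall k \near U, `|u k| <= B) -> cvg (u @ U).
Proof.
move=> UU uB.
have [|p [_ pP]] := @segment_compact R (- B) B (u @ U) _.
  by apply: filterS uB => k /=; rewrite in_itv/= ler_norml.
apply: (cvgP p) => V Vp.
have [//|nV] := in_ultra_setVsetC (u @^-1` V) UU.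
by have [y []] := pP (~` V) V nV Vp.
Qed.

(** * Cosine sums and their discrete orthogonality *)

Section trigonometric_sums.
Context {R : realType}.
Implicit Types (a b j l : nat) (t x : R).

(** The frequency is kept as a pair of naturals and subtracted in [R], so that negative differences
    are not truncated. *)
Definition cosd a b t : R := cos (2 * pi * t * (a%:R - b%:R)).

Lemma cosdC a b t : cosd a b t = cosd b a t.
Proof. by rewrite /cosd -(opprB b%:R) mulrN cosN. Qed.

Lemma cosd_xx a t : cosd a a t = 1.
Proof. by rewrite /cosd subrr mulr0 cos0. Qed.

Lemma cosdE a b t : cosd a b t =
  cos (2 * pi * t * a%:R) * cos (2 * pi * t * b%:R) +
  sin (2 * pi * t * a%:R) * sin (2 * pi * t * b%:R).
Proof. by rewrite -cosB -mulrBr. Qed.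

(** Product-to-sum, with the sum and the difference of the two frequencies rewritten as differences
    of naturals. *)
Lemma cosdM a b j l t : cosd a b t * cosd j l t =
  (cosd (a + j) (b + l) t + cosd (a + l) (b + j) t) / 2.
Proof.
rewrite /cosd !natrD.
set y := 2 * pi * t.
have -> : y * (a%:R + j%:R - (b%:R + l%:R)) = y * (a%:R - b%:R) + y * (j%:R - l%:R) by ring.
have -> : y * (a%:R + l%:R - (b%:R + j%:R)) = y * (a%:R - b%:R) - y * (j%:R - l%:R) by ring.
by rewrite cosD cosB; field.
Qed.

Lemma continuous_cosd a b : continuous (cosd a b).
Proof.
move=> t; apply: continuous_comp; last exact: continuous_cos.
by apply: continuousM (cvg_cst _); apply: continuousM (cvg_cst _) cvg_id.
Qed.

(** Each term satisfies 2 sin (x / 2) cos (s x) = sin (s x + x / 2) - sin (s x - x / 2). *)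
Lemma sum_cos_telescope x M :
  2 * sin (x / 2) * (\sum_(s < M) cos (s%:R * x)) =
  sin (M%:R * x - x / 2) + sin (x / 2).
Proof.
elim: M => [|M IH]; first by rewrite big_ord0 mulr0 mul0r sub0r sinN addNr.
rewrite big_ord_recr/= mulrDr IH.
have -> : M.+1%:R * x - x / 2 = M%:R * x + x / 2 by rewrite -natr1; field.
by rewrite sinB sinD; ring.
Qed.

(** The hypotheses say |a - b| < M. For d = a - b > 0 and x = 2 pi d / M, the telescoped sum is 0
    because M x is a multiple of 2 pi, while sin (x / 2) > 0 because 0 < x / 2 < pi. *)
Lemma cosd_orthogonal M a b : (a < b + M)%N -> (b < a + M)%N ->
  \sum_(s < M) cosd a b (s%:R / M%:R) = (M * (a == b))%:R :> R.
Proof.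
wlog ba : a b / (b <= a)%N.
  move=> H aM bM; have [ba|/ltnW ab] := leqP b a; first exact: H.
  rewrite eq_sym -H//; apply: eq_bigr => s _; exact: cosdC.
move=> aM _; have [<-|ab] := eqVneq a b.
  under eq_bigr do rewrite cosd_xx.
  by rewrite sumr_const card_ord muln1.
have M0 : (0 < M)%N by lia.
have M0' : M%:R != 0 :> R by rewrite pnatr_eq0 -lt0n.
rewrite muln0; set d := (a - b)%N.
pose x : R := 2 * pi * d%:R / M%:R.
have -> : \sum_(s < M) cosd a b (s%:R / M%:R) = \sum_(s < M) cos (s%:R * x).
  by apply: eq_bigr => s _; rewrite /cosd -natrB// -/d /x; congr cos; field.
have sx : 0 < sin (x / 2).
  have -> : x / 2 = pi * (d%:R / M%:R) by rewrite /x; field.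
  apply: sin_gt0_pi; rewrite mulr_gt0 ?pi_gt0 ?divr_gt0 ?ltr0n ?gtr_pMr ?pi_gt0//=; last by lia.
  by rewrite ltr_pdivrMr ?ltr0n// mul1r ltr_nat; lia.
have : 2 * sin (x / 2) * (\sum_(s < M) cos (s%:R * x)) = 0.
  rewrite sum_cos_telescope.
  have -> : M%:R * x - x / 2 = - (x / 2) + (pi *+ 2) *+ d.
    by rewrite /x -[(pi *+ 2) *+ d]mulr_natl -[pi *+ 2]mulr_natl; field.
  by rewrite (periodicn (@sinD2pi R)) sinN addNr.
by move/eqP; rewrite !mulf_eq0 gt_eqF// (gt_eqF sx)/= => /eqP.
Qed.

End trigonometric_sums.

Lemma sum_ord_eqn (K m b : nat) :
  (\sum_(j < K) (m == b + j)%N)%N = ((b <= m)%N && (m < b + K)%N).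
Proof.
elim: K => [|K IH]; first by rewrite big_ord0; lia.
by rewrite big_ord_recr/= IH; lia.
Qed.

(** The sum counts the points of a diagonal of the K by K square, of which there are K - |a - b|.
    The cruder bound K - (a + b) is symmetric in a and b, and suffices after division by K. *)
Lemma sum_ord_diagonal (K a b : nat) : (a + b <= K)%N ->
  (K - (a + b) <= \sum_(l < K) \sum_(j < K) (a + l == b + j) <= K)%N.
Proof.
move=> abK; under eq_bigr do rewrite sum_ord_eqn.
apply/andP; split; last first.
  apply: (@leq_trans (\sum_(l < K) 1)%N); last by rewrite sum1_card card_ord.
  by apply: leq_sum => l _; case: (_ && _).
rewrite -(big_mkord predT (fun l => ((b <= a + l) && (a + l < b + K))%N : nat)).
rewrite (big_cat_nat (n := b)) ?leq0n//=; last by lia.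
(* On the middle range b <= l < K - a both inequalities hold, so every term there is 1. *)
rewrite (big_cat_nat (m := b) (n := K - a)%N)//=; [|lia..].
rewrite addnCA (leq_trans _ (leq_addr _ _))//.
rewrite -[leqLHS]muln1 subnDA -sum_nat_const_nat.
rewrite big_nat_cond [leqRHS]big_nat_cond leq_sum// => i; lia.
Qed.

(** * Positive definite sequences *)

Section herglotz.
Context {R : realType}.
Variable gamma : nat -> nat -> R.
Hypothesis gammaC : forall j l, gamma j l = gamma l j.
Hypothesis gammaS : forall j l, gamma j.+1 l.+1 = gamma j l.
Hypothesis gamma_psd : forall K (c : nat -> R),
  0 <= \sum_(j < K) \sum_(l < K) c j * c l * gamma j l.

Let w K t := \sum_(j < K) \sum_(l < K) gamma j l * cosd j l t.

(** The subtraction formula for the cosine makes [w K t] the sum of the values of the form of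
    [gamma] at two real vectors, one of cosines and one of sines. *)
Let w_ge0 K t : 0 <= w K t.
Proof.
have -> : w K t =
    \sum_(j < K) \sum_(l < K) cos (2 * pi * t * j%:R) * cos (2 * pi * t * l%:R) * gamma j l +
    \sum_(j < K) \sum_(l < K) sin (2 * pi * t * j%:R) * sin (2 * pi * t * l%:R) * gamma j l.
  rewrite -big_split; apply: eq_bigr => j _; rewrite -big_split; apply: eq_bigr => l _ /=.
  by rewrite cosdE; ring.
apply: addr_ge0.
- exact: (gamma_psd K (fun j => cos (2 * pi * t * j%:R))).
- exact: (gamma_psd K (fun j => sin (2 * pi * t * j%:R))).
Qed.

(** The constant is 1 / (2 K), the mesh of the nodes, times 1 / K, the normalisation of [w K]. *)
Let riemann K (phi : R -> R) :=
  (2 * K%:R ^+ 2)^-1 * \sum_(s < 2 * K) phi (s%:R / (2 * K)%:R) * w K (s%:R / (2 * K)%:R).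

Let gammaD j l k : gamma (j + k) (l + k) = gamma j l.
Proof. by elim: k => [|k IH]; rewrite ?addn0// !addnS gammaS. Qed.

(** Orthogonality over 2 K nodes keeps the pairs with j - l = a - b or j - l = b - a, where symmetry
    and shift invariance give gamma j l = gamma a b; only their number remains. The bound on a + b
    keeps all frequencies below 2 K. *)
Let riemann_cosd K a b : (a + b < K)%N -> riemann K (cosd a b) =
  gamma a b * (\sum_(l < K) \sum_(j < K) (a + l == b + j))%:R / K%:R.
Proof.
move=> abK; have K0 : K%:R != 0 :> R by rewrite pnatr_eq0; lia.
have E : \sum_(s < 2 * K) cosd a b (s%:R / (2 * K)%:R) * w K (s%:R / (2 * K)%:R) =
    \sum_(j < K) \sum_(l < K) gamma j l * (K * (a + j == b + l) + K * (a + l == b + j))%:R.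
  under eq_bigr do rewrite /w mulr_sumr.
  rewrite exchange_big; apply: eq_bigr => j _ /=.
  under eq_bigr do rewrite mulr_sumr.
  rewrite exchange_big; apply: eq_bigr => l _ /=.
  under eq_bigr do rewrite mulrCA cosdM.
  rewrite -mulr_sumr; congr (_ * _).
  rewrite -mulr_suml big_split/= !cosd_orthogonal; [|move: (ltn_ord j) (ltn_ord l); lia..].
  by rewrite natrD !natrM; field.
have sym : \sum_(j < K) \sum_(l < K) gamma j l * (a + j == b + l)%:R =
           \sum_(j < K) \sum_(l < K) gamma j l * (a + l == b + j)%:R.
  rewrite exchange_big; apply: eq_bigr => j _; apply: eq_bigr => l _ /=.
  by rewrite gammaC.
have cnt : \sum_(j < K) \sum_(l < K) gamma j l * (a + l == b + j)%:R =
    gamma a b * (\sum_(l < K) \sum_(j < K) (a + l == b + j))%:R.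
  rewrite exchange_big natr_sum mulr_sumr; apply: eq_bigr => l _ /=.
  rewrite natr_sum mulr_sumr; apply: eq_bigr => j _ /=.
  have [e|_] := eqVneq (a + l)%N (b + j)%N; last by rewrite !mulr0.
  (* Shifting (j, l) by b gives (a + l, b + l), since a + l = b + j; this is (a, b) shifted by l. *)
  by rewrite !mulr1 -(gammaD j l b) addnC -e [(l + b)%N]addnC [in LHS]addnC addnC gammaD.
rewrite /riemann E.
have -> : \sum_(j < K) \sum_(l < K) gamma j l * (K * (a + j == b + l) + K * (a + l == b + j))%:R =
    2 * K%:R * (gamma a b * (\sum_(l < K) \sum_(j < K) (a + l == b + j))%:R).
  transitivity (K%:R * (\sum_(j < K) \sum_(l < K) gamma j l * (a + j == b + l)%:R) +
                K%:R * (\sum_(j < K) \sum_(l < K) gamma j l * (a + l == b + j)%:R)).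
    rewrite -mulrDr -big_split mulr_sumr; apply: eq_bigr => j _ /=.
    rewrite -big_split mulr_sumr; apply: eq_bigr => l _ /=.
    by rewrite natrD !natrM; ring.
  by rewrite sym cnt; ring.
by field.
Qed.

Let riemann_cvg a b : (fun K => riemann K (cosd a b)) @ \oo --> gamma a b.
Proof.
pose r K : R := (\sum_(l < K) \sum_(j < K) (a + l == b + j))%:R / K%:R.
have r1 : r @ \oo --> (1 : R).
  apply: (@squeeze_cvgr _ _ _ _ (fun K => 1 - (a + b).+1%:R * K%:R^-1) (cst 1)).
  - exists (a + b).+1 => // K /= abK.
    have K0 : 0 < K%:R :> R by rewrite ltr0n; lia.
    have /andP[lo up] := @sum_ord_diagonal K a b (ltnW abK).
    rewrite /r ler_pdivrMr// mul1r ler_nat up andbT ler_pdivlMr//.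
    rewrite mulrBl mul1r mulfVK ?gt_eqF// lerBlDr -natrD ler_nat; lia.
  - rewrite -[X in _ --> X]subr0 -[X in _ --> _ - X](mulr0 (a + b).+1%:R).
    apply: cvgB; first exact: cvg_cst.
    apply: cvgMl_tmp; apply/gtr0_cvgV0; last exact: cvgr_idn.
    by exists 1%N => // K /= K0; rewrite ltr0n.
  - exact: cvg_cst.
have := cvgMl_tmp (a := gamma a b) r1; rewrite mulr1 => H; apply: cvg_trans; [|exact: H].
apply: near_eq_cvg; exists (a + b).+1 => // K /= abK.
by rewrite riemann_cosd// /r mulrA.
Qed.

Let riemann_comb K a (f g : R -> R) :
  riemann K (fun x => a * f x + g x) = a * riemann K f + riemann K g.
Proof.
rewrite /riemann (mulrCA a) -mulrDr; congr (_ * _).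
rewrite mulr_sumr -big_split/=.
by apply: eq_bigr => s _; rewrite mulrDl mulrA.
Qed.

Let riemann_ge0 K (f : R -> R) : (forall x, `[0, 1]%classic x -> 0 <= f x) -> 0 <= riemann K f.
Proof.
move=> f0; rewrite mulr_ge0 ?invr_ge0 ?mulr_ge0 ?sqr_ge0// sumr_ge0// => s _.
rewrite mulr_ge0// f0//= in_itv/= divr_ge0//=.
have : (s < 2 * K)%N := ltn_ord s.
rewrite -(ltr_nat R) => sK; rewrite ler_pdivrMr ?mul1r ?ltW//.
exact: le_lt_trans sK.
Qed.

(* The weight [w K / K] is the Fejer mean of the kernel, and L the limit of the
   Riemann sums against it along an ultrafilter. With 2 K nodes, frequencies of
   size below 2 K are not aliased. *)
Lemma herglotz : exists L : (R -> R) -> R,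
  positive_functional (`[0, 1]%classic : set R) L /\ forall a b, L (cosd a b) = gamma a b.
Proof.
have [U [UU oU]] := ultraFilterLemma eventually_filter.
have cv (f : R -> R) : continuous f -> cvg (riemann K f @[K --> U]).
  move=> cf.
  have [B [_ HB]] : bounded_set (f @` `[0, 1]).
    apply: compact_bounded; apply: continuous_compact (@segment_compact R 0 1).
    exact: continuous_subspaceT.
  have fB x : `[0, 1]%classic x -> `|f x| <= B + 1.
    by move=> x01; apply: (HB (B + 1)); [rewrite ltrDl|exists x].
  apply: (@ultra_bounded_cvg R U _ ((B + 1) * gamma 0 0)) => //.
  apply: oU; exists 1%N => // K /= K0.
  (* The total mass is [gamma 0 0] for every K > 0, so the Riemann sums of f are bounded uniformly
     in K. The constant c is written (c - 1) * 1 + 1 with both ones equal to [cosd 0 0]. *)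
  have c1 (c : R) : riemann K (fun=> c) = c * gamma 0 0.
    have := riemann_comb K (c - 1) (cosd 0 0) (cosd 0 0).
    under eq_fun do rewrite cosd_xx mulr1 subrK.
    move=> ->; rewrite riemann_cosd//.
    under eq_bigr do under eq_bigr do rewrite !add0n.
    under eq_bigr do rewrite (sum_ord_eqn K _ 0) leq0n add0n ltn_ord/=.
    rewrite sum1_card card_ord; field; rewrite pnatr_eq0; lia.
  have H0 (e : R) : `|e| <= 1 -> e * riemann K f <= (B + 1) * gamma 0 0.
    move=> e1; rewrite -c1 -subr_ge0 addrC -mulNr -riemann_comb.
    apply: riemann_ge0 => x /fB fx; rewrite mulNr addrC subr_ge0.
    apply: le_trans (ler_norm _) _; rewrite normrM.
    by apply: le_trans fx; rewrite ler_piMl.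
  rewrite ler_norml -lerN2 opprK andbC.
  have := H0 1; have := H0 (-1); rewrite normrN normr1 mulN1r mul1r lexx.
  by move=> -> // -> //.
exists (fun f => lim (riemann K f @[K --> U])); split; first split.
- move=> a f g cf cg.
  apply: cvg_lim => //; under eq_fun do rewrite riemann_comb.
  by apply: cvgD; [apply: cvgMl_tmp|]; exact: cv.
- move=> f cf f0; apply: limr_ge; first exact: cv.
  by near=> K; exact: riemann_ge0.
(* [U] refines the filter at infinity, so the ordinary limit is also the limit along [U]. *)
- move=> a b; apply: cvg_lim => // V /(@riemann_cvg a b); exact: oU.
Unshelve. all: by end_near.
Qed.

End herglotz.

(** * Trigonometric polynomials and Toeplitz quadratic forms *)

Section trigonometric_polynomials.
Context {R : realType}.
Implicit Types s : seq (R * nat).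

(* The seq [s] stands for the polynomial [\sum_(p <- s) p.1 X^p.2]; [trig_re]
   and [trig_im] are the real and imaginary parts of its value at e^(2 pi i t). *)
Definition trig_re s (t : R) := \sum_(p <- s) p.1 * cos (2 * pi * t * p.2%:R).

Definition trig_im s (t : R) := \sum_(p <- s) p.1 * sin (2 * pi * t * p.2%:R).

Definition quad_form (gamma : nat -> nat -> R) s :=
  \sum_(p <- s) \sum_(q <- s) p.1 * q.1 * gamma p.2 q.2.

Lemma trig_sqrE s t : trig_re s t ^+ 2 + trig_im s t ^+ 2 =
  \sum_(p <- s) \sum_(q <- s) p.1 * q.1 * cosd p.2 q.2 t.
Proof.
rewrite !expr2 /trig_re /trig_im !mulr_suml -big_split; apply: eq_bigr => p _ /=.
rewrite !mulr_sumr -big_split; apply: eq_bigr => q _ /=.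
by rewrite cosdE; ring.
Qed.

Lemma trig_sqr_le s t : trig_re s t ^+ 2 + trig_im s t ^+ 2 <=
  (\sum_(p <- s) `|p.1|) ^+ 2.
Proof.
rewrite trig_sqrE expr2 mulr_suml; apply: ler_sum => p _.
rewrite mulr_sumr; apply: ler_sum => q _.
apply: le_trans (ler_norm _) _; rewrite !normrM ler_piMr ?mulr_ge0//.
by rewrite ler_norml cos_geN1 cos_le1.
Qed.

Theorem quad_form_cvg0 (gamma : nat -> nat -> R) (s : nat -> seq (R * nat)) (C : R) :
  (forall j l, gamma j l = gamma l j) ->
  (forall j l, gamma j.+1 l.+1 = gamma j l) ->
  (forall K (c : nat -> R),
     0 <= \sum_(j < K) \sum_(l < K) c j * c l * gamma j l) ->
  (forall k, \sum_(p <- s k) `|p.1| <= C) ->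
  (forall t, 0 <= t <= 1 -> (fun k => trig_re (s k) t) @ \oo --> 0) ->
  (forall t, 0 <= t <= 1 -> (fun k => trig_im (s k) t) @ \oo --> 0) ->
  (fun k => quad_form gamma (s k)) @ \oo --> 0.
Proof.
move=> gammaC gammaS gamma_psd sC re0 im0.
have [L [Lpos Lcosd]] := herglotz gammaC gammaS gamma_psd.
have cc (p q : R * nat) : continuous (fun t : R => p.1 * q.1 * cosd p.2 q.2 t).
  by move=> t; exact: continuousM (cvg_cst _) (@continuous_cosd _ _ _ t).
have cs k (p : R * nat) : continuous (fun t : R => \sum_(q <- s k) p.1 * q.1 * cosd p.2 q.2 t).
  by apply: continuous_sumT => q; exact: cc.
pose h k t := trig_re (s k) t ^+ 2 + trig_im (s k) t ^+ 2.
have hE k : h k = fun t => \sum_(p <- s k) \sum_(q <- s k) p.1 * q.1 * cosd p.2 q.2 t.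
  by apply/funext => t; exact: trig_sqrE.
have Lh k : L (h k) = quad_form gamma (s k).
  rewrite hE (functional_sum Lpos)//; apply: eq_bigr => p _.
  rewrite (functional_sum Lpos)//; apply: eq_bigr => q _.
  by rewrite (functionalZ Lpos) ?Lcosd//; exact: continuous_cosd.
under eq_fun do rewrite -Lh.
apply: (functional_bounded_convergence Lpos (C := C ^+ 2) (@segment_compact R 0 1)).
- by move=> k; rewrite hE; exact: continuous_sumT.
- by move=> k t _; rewrite addr_ge0 ?sqr_ge0.
- move=> k t _; apply: le_trans (trig_sqr_le _ _) _.
  by rewrite lerXn2r ?nnegrE ?sumr_ge0// (le_trans _ (sC k)) ?sumr_ge0.
- move=> t /=; rewrite in_itv/= => t01.
  suff : h ^~ t @ \oo --> (0 * 0 + 0 * 0 : R) by rewrite mulr0 addr0.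
  exact: cvgD (cvgM (re0 t t01) (re0 t t01)) (cvgM (im0 t t01) (im0 t t01)).
Qed.

End trigonometric_polynomials.

(** * Real square integrable functions *)

Section square_integrable.
Context {d} {T : measurableType d} {R : realType} (mu : probability T R).
Implicit Types u v w : T -> R.

Definition sqint u := measurable_fun setT u /\ mu.-integrable setT (EFin \o (fun x => u x ^+ 2)).

Definition dotp u v : R := \int[mu]_x (u x * v x).

Let le_int u v : measurable_fun setT u -> mu.-integrable setT (EFin \o v) ->
  (forall x, `|u x| <= v x) -> mu.-integrable setT (EFin \o u).
Proof.
move=> mu_ iv uv; apply: le_integrable iv => //; first exact/measurable_EFinP.
by move=> x _ /=; rewrite lee_fin (le_trans (uv x))// ler_norm.
Qed.

Lemma sqint_mul u v : sqint u -> sqint v -> mu.-integrable setT (EFin \o (fun x => u x * v x)).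
Proof.
move=> [mu_ iu] [mv iv].
apply: (@le_int _ (fun x => u x ^+ 2 + v x ^+ 2)).
- exact: measurable_funM.
- exact: (integrableD _ iu iv).
- move=> x; rewrite normrM -[u x ^+ 2]real_normK ?num_real// -[v x ^+ 2]real_normK ?num_real//.
  have := sqr_ge0 (`|u x| - `|v x|); have := sqr_ge0 `|u x|; have := sqr_ge0 `|v x|.
  by rewrite sqrrB; lra.
Qed.

Lemma sqint_comb (a : R) u v : sqint u -> sqint v -> sqint (fun x => a * u x + v x).
Proof.
move=> su sv; split.
  by apply: measurable_funD sv.1; apply: measurable_funM su.1.
have -> : EFin \o (fun x => (a * u x + v x) ^+ 2) =
  ((fun x => ((a ^+ 2)%:E * (u x ^+ 2)%:E + (a *+ 2)%:E * (u x * v x)%:E)%E) \+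
   (fun x => (v x ^+ 2)%:E))%E.
  by apply/funext => x /=; rewrite -!EFinM -!EFinD; congr (_%:E); ring.
apply: integrableD (sv.2) => //; apply: integrableD => //; apply: integrableZl => //.
- exact: su.2.
- exact: sqint_mul.
Qed.

Lemma sqint_cst (a : R) : sqint (cst a).
Proof. by split => //; exact: (finite_measure_integrable_cst mu (a ^+ 2)). Qed.

Lemma sqint0 : sqint (fun=> 0).
Proof. exact: sqint_cst. Qed.

Lemma sqintZ (a : R) u : sqint u -> sqint (fun x => a * u x).
Proof. by move=> su; under eq_fun do rewrite -[_ * _]addr0; exact: sqint_comb sqint0. Qed.

Lemma sqintD u v : sqint u -> sqint v -> sqint (fun x => u x + v x).
Proof. by move=> su sv; under eq_fun do rewrite -[u _]mul1r; exact: sqint_comb. Qed.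

Lemma sqintB u v : sqint u -> sqint v -> sqint (fun x => u x - v x).
Proof.
move=> su sv; under eq_fun do rewrite addrC -mulN1r; exact: sqint_comb.
Qed.

Lemma sqint_sum (I : Type) (r : seq I) (F : I -> T -> R) :
  (forall i, sqint (F i)) -> sqint (fun x => \sum_(i <- r) F i x).
Proof.
move=> sF; elim: r => [|i r IH].
  by under eq_fun do rewrite big_nil; exact: sqint0.
by under eq_fun do rewrite big_cons; exact: sqintD.
Qed.

Lemma dotpC u v : dotp u v = dotp v u.
Proof. by rewrite /dotp; under eq_fun do rewrite mulrC. Qed.

Lemma dotp_comb (a : R) u v w : sqint u -> sqint v -> sqint w ->
  dotp (fun x => a * u x + v x) w = a * dotp u w + dotp v w.
Proof.
move=> su sv sw; rewrite /dotp -RintegralZl//; last exact: sqint_mul.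
rewrite -RintegralD//; last 2 first.
- have -> : EFin \o (fun x => a * (u x * w x)) = (fun x => a%:E * (u x * w x)%:E)%E.
    by apply/funext => x /=; rewrite -EFinM.
  by apply: integrableZl => //; exact: sqint_mul.
- exact: sqint_mul.
by apply: eq_Rintegral => x _; ring.
Qed.

Lemma dotp0l w : dotp (fun=> 0) w = 0.
Proof.
rewrite /dotp; under eq_fun do rewrite mul0r.
by rewrite Rintegral_cst// mul0r.
Qed.

Lemma dotpDl u v w : sqint u -> sqint v -> sqint w ->
  dotp (fun x => u x + v x) w = dotp u w + dotp v w.
Proof.
move=> su sv sw; rewrite -[dotp u w]mul1r -dotp_comb//.
by rewrite /dotp; under [in RHS]eq_fun do rewrite mul1r.
Qed.

Lemma dotpBl u v w : sqint u -> sqint v -> sqint w ->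
  dotp (fun x => u x - v x) w = dotp u w - dotp v w.
Proof.
move=> su sv sw; rewrite addrC -mulN1r -dotp_comb//.
by rewrite /dotp; under [in RHS]eq_fun do rewrite mulN1r [- _ + _]addrC.
Qed.

Lemma dotpZl (a : R) u w : sqint u -> sqint w -> dotp (fun x => a * u x) w = a * dotp u w.
Proof.
move=> su sw; rewrite -[RHS]addr0 -(dotp0l w) -dotp_comb//; last exact: sqint0.
by rewrite /dotp; under [in RHS]eq_fun do rewrite addr0.
Qed.

Lemma dotp_suml (I : Type) (r : seq I) (F : I -> T -> R) w :
  (forall i, sqint (F i)) -> sqint w ->
  dotp (fun x => \sum_(i <- r) F i x) w = \sum_(i <- r) dotp (F i) w.
Proof.
move=> sF sw; elim: r => [|i r IH].
  by rewrite big_nil; under eq_fun do rewrite big_nil; rewrite dotp0l.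
by rewrite big_cons -IH -dotpDl//; [under eq_fun do rewrite big_cons|exact: sqint_sum].
Qed.

Lemma dotp_ge0 u : 0 <= dotp u u.
Proof. by apply: Rintegral_ge0 => x _; rewrite -expr2 sqr_ge0. Qed.

Lemma dotpE u : sqint u -> (dotp u u)%:E = (\int[mu]_x ((u x ^+ 2)%:E))%E.
Proof.
by move=> [_ iu]; rewrite /dotp fineK//; exact: integrable_fin_num.
Qed.

Lemma sqint_measurable_sqr u : sqint u -> measurable_fun setT (fun x => (u x ^+ 2)%:E).
Proof. by move=> su; exact/measurable_EFinP/measurable_funX/su.1. Qed.

Lemma dotp_eq0 u : sqint u -> dotp u u = 0 -> {ae mu, forall x, u x = 0}.
Proof.
move=> su u0.
have mu2 := sqint_measurable_sqr su.
have := (ae_eq_integral_abs mu measurableT mu2).1; case.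
  under eq_integral do rewrite gee0_abs ?lee_fin ?sqr_ge0//.
  by rewrite -dotpE// u0.
move=> N [mN N0 sub]; exists N; split => // x /= ux; apply: sub => /= /(_ I) [] /eqP.
by rewrite sqrf_eq0 => /eqP.
Qed.

(** Expand <u - e a v, u - e a v> >= 0 for e = 1 and e = -1, and divide by a. The free weight a lets
    this serve as the Cauchy-Schwarz inequality. *)
Lemma dotp_le_young u v (a : R) : 0 < a -> sqint u -> sqint v ->
  2 * `|dotp u v| <= a^-1 * dotp u u + a * dotp v v.
Proof.
move=> a0 su sv.
have H (e : R) : e ^+ 2 = 1 -> 2 * (e * dotp u v) <= a^-1 * dotp u u + a * dotp v v.
  move=> e2; have sw := sqint_comb (- (e * a)) sv su.
  have := dotp_ge0 (fun x => - (e * a) * v x + u x).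
  rewrite dotp_comb// [dotp v (fun x => _ + _)]dotpC [dotp u (fun x => _ + _)]dotpC.
  rewrite !dotp_comb// [dotp v u]dotpC => H.
  have : 0 <= a^-1 * (- (e * a) * (- (e * a) * dotp v v + dotp u v) +
                 (- (e * a) * dotp u v + dotp u u)).
    by rewrite mulr_ge0// invr_ge0 ltW.
  have -> : a^-1 * (- (e * a) * (- (e * a) * dotp v v + dotp u v) +
                 (- (e * a) * dotp u v + dotp u u)) =
       e ^+ 2 * a * dotp v v - 2 * (e * dotp u v) + a^-1 * dotp u u.
    by field; lra.
  by rewrite e2 mul1r; lra.
have := H 1 (expr1n _ _); have := H (-1) _; rewrite sqrrN expr1n => /(_ erefl).
by rewrite mul1r; case: (ger0P (dotp u v)); lra.
Qed.

Lemma dotp_cvg0 (u : nat -> T -> R) w : (forall k, sqint (u k)) -> sqint w ->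
  (fun k => dotp (u k) (u k)) @ \oo --> 0 -> (fun k => dotp (u k) w) @ \oo --> 0.
Proof.
move=> su sw /cvgrPdist_lt u0; apply/cvgrPdist_lt => e e0.
have ww := dotp_ge0 w.
(* Then a <w, w> = e - a, and a^-1 <u k, u k> < e eventually, so 2 |<u k, w>| < 2 e. *)
pose a := e / (1 + dotp w w).
have a0 : 0 < a by rewrite divr_gt0//; lra.
have aw : a * dotp w w = e - a by rewrite /a; field; lra.
near=> k; rewrite sub0r normrN.
have := dotp_le_young a0 (su k) sw; rewrite aw.
have : a^-1 * dotp (u k) (u k) < e.
  rewrite mulrC ltr_pdivrMr//.
  have : `|0 - dotp (u k) (u k)| < e * a by near: k; exact: u0 (mulr_gt0 e0 a0).
  by rewrite sub0r normrN ger0_norm// dotp_ge0.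
lra.
Unshelve. all: by end_near.
Qed.

Lemma dotp_parallelogram_le u v : sqint u -> sqint v ->
  dotp (fun x => u x + v x) (fun x => u x + v x) <= 2 * dotp u u + 2 * dotp v v.
Proof.
move=> su sv; have sD := sqintD su sv; have sB := sqintB su sv.
have := dotp_ge0 (fun x => u x - v x).
rewrite dotpBl// [dotp u (fun x => _ - _)]dotpC [dotp v (fun x => _ - _)]dotpC !dotpBl//.
rewrite dotpDl// [dotp u (fun x => _ + _)]dotpC [dotp v (fun x => _ + _)]dotpC !dotpDl//.
by rewrite [dotp v u]dotpC; lra.
Qed.

Lemma sqint_norm u : sqint u -> sqint (fun x => `|u x|).
Proof.
move=> [mu_ iu]; split; first exact: measurableT_comp.
by under eq_fun do rewrite real_normK ?num_real//.
Qed.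

(** On a probability space the L^1 norm is at most the L^2 norm: pair |u| with the constant 1, of
    norm 1, using weight a. *)
Lemma integral_normr_le u (a : R) : 0 < a -> sqint u -> dotp u u <= a ^+ 2 ->
  (\int[mu]_x (`|u x|%:E) <= a%:E)%E.
Proof.
move=> a0 su ua; have sn := sqint_norm su; have s1 := sqint_cst 1.
have -> : (\int[mu]_x (`|u x|%:E))%E = (dotp (fun x => `|u x|) (cst 1))%:E.
  rewrite /dotp fineK; first by under [RHS]eq_integral do rewrite mulr1.
  by apply: integrable_fin_num => //; exact: sqint_mul.
rewrite lee_fin; have := dotp_le_young a0 sn s1.
have -> : dotp (cst 1) (cst 1) = 1.
  rewrite -[RHS](_ : \int[mu]_(x in setT) 1 = 1); last first.
    rewrite Rintegral_cst// -[RHS](mulr1 1); congr (_ * _).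
    by rewrite [X in fine X](_ : _ = 1%E)//; exact: probability_setT.
  by apply: eq_Rintegral => x _; rewrite /= mulr1.
have -> : dotp (fun x => `|u x|) (fun x => `|u x|) = dotp u u.
  by rewrite /dotp; apply: eq_Rintegral => x _; rewrite -!expr2 real_normK ?num_real.
have : a^-1 * dotp u u <= a by rewrite mulrC ler_pdivrMr// -expr2.
have := ler_norm (dotp (fun x => `|u x|) (cst 1)); lra.
Qed.

Lemma sqint_fin u : measurable_fun setT u ->
  (\int[mu]_x ((u x ^+ 2)%:E) < +oo)%E -> sqint u.
Proof.
move=> mu_ fu; split => //; apply/integrableP; split.
  exact/measurable_EFinP/measurable_funX.
by under eq_integral do rewrite /= ger0_norm ?sqr_ge0//.
Qed.

Lemma limn_einf_le (f : nat -> \bar R) (e : \bar R) k0 :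
  (forall k, (k0 <= k)%N -> (f k <= e)%E) -> (limn_einf f <= e)%E.
Proof.
move=> fe; rewrite limn_einf_lim; apply: lime_le; first exact: is_cvg_einfs.
apply: nearW => m; apply: le_trans (fe (maxn m k0) (leq_maxr _ _)).
by apply: ereal_inf_lbound; exists (maxn m k0) => //=; exact: leq_maxl.
Qed.

(** * Completeness of L^2 *)

Section fast_cauchy.
Variable u : nat -> T -> R.
Hypothesis su : forall k, sqint (u k).
Hypothesis fast : forall k, dotp (fun x => u k.+1 x - u k x) (fun x => u k.+1 x - u k x)
  <= (2^-1 ^+ k) ^+ 2.

(** The increments have L^1 norm at most 2^-k, so the sum of their absolute values has integral at
    most 2 and is finite almost everywhere; there the telescoping series converges absolutely. *)
Lemma fast_cauchy_ae_cvg : {ae mu, forall x, cvgn (fun k => u k x)}.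
Proof.
pose D k x := u k.+1 x - u k x.
have sD k : sqint (D k) by exact: sqintB.
have mD k : measurable_fun setT (fun x => `|D k x|%:E).
  exact/measurable_EFinP/measurableT_comp/(sD k).1.
pose g x := (\sum_(0 <= k <oo) `|D k x|%:E)%E.
have g0 x : (0 <= g x)%E by apply: nneseries_ge0 => k _ _; rewrite lee_fin.
have ig : mu.-integrable setT g.
  apply/integrableP; split; first exact: ge0_emeasurable_sum.
  under eq_integral do rewrite gee0_abs//.
  rewrite integral_nneseries//.
  apply: (@le_lt_trans _ _ 2%:E); last exact: ltry.
  apply: lime_le; first by apply: is_cvg_nneseries => k _ _; exact: integral_ge0.
  apply: nearW => m; apply: (@le_trans _ _ (\sum_(0 <= k < m) (2^-1 ^+ k)%:E)%E).
    apply: lee_sum => k _; apply: integral_normr_le (sD k) (fast k).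
    by rewrite exprn_gt0.
  rewrite sumEFin lee_fin; suff : \sum_(0 <= i < m) 2^-1 ^+ i = 2 - 2 * 2^-1 ^+ m :> R.
    by move=> ->; rewrite gerBl mulr_ge0// exprn_ge0.
  elim: m => [|m IH]; first by rewrite big_nil expr0; lra.
  by rewrite big_nat_recr//= IH exprS; lra.
have := integrable_ae measurableT ig; apply: filterS => x /(_ I) gx.
have cD : cvgn (series (D ^~ x)).
  by apply: normed_cvg; apply: nnseries_is_cvg => [k|]; rewrite ?normr_ge0//; move: gx; rewrite fin_numElt => /andP[].
have -> : (fun k => u k x) = (fun k => u 0 x + series (D ^~ x) k).
  apply/funext; elim=> [|k IH]; first by rewrite /series/= big_nil addr0.
  by rewrite seriesSr addrA -IH /D; ring.
by apply: is_cvgD => //; exact: is_cvg_cst.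
Qed.

End fast_cauchy.

(** Riesz-Fischer: a fast subsequence converges almost everywhere, and Fatou's lemma bounds the
    distance from u N to its limit by the distances from u N to late members of the subsequence. *)
Theorem sqint_complete (u : nat -> T -> R) : (forall k, sqint (u k)) ->
  (forall e, 0 < e -> exists K, forall N M, (K <= N)%N -> (K <= M)%N ->
     dotp (fun x => u N x - u M x) (fun x => u N x - u M x) <= e) ->
  exists2 v, sqint v &
    (fun N => dotp (fun x => u N x - v x) (fun x => u N x - v x)) @ \oo --> 0.
Proof.
move=> su cu.
have /choice[K KP] : forall k, exists K, forall N M, (K <= N)%N -> (K <= M)%N ->
     dotp (fun x => u N x - u M x) (fun x => u N x - u M x) <= (2^-1 ^+ k) ^+ 2.
  by move=> k; apply: cu; rewrite !exprn_gt0.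
(* Both n k and n (k + 1) are at least K k, so consecutive terms of the subsequence are 2^-k
   close. *)
pose n k := (k + \sum_(i < k.+1) K i)%N.
have Kn k : (K k <= n k)%N by rewrite /n big_ord_recr/= addnA leq_addl.
have KnS k : (K k <= n k.+1)%N.
  by rewrite /n 2!big_ord_recr/=; lia.
have ae := fast_cauchy_ae_cvg (fun k => su (n k)) (fun k => KP k _ _ (KnS k) (Kn k)).
(* The upper limit is measurable on the whole space and equals the limit wherever the subsequence
   converges; [fine] gives an arbitrary real value where it is infinite. *)
pose v x := fine (limn_esup (fun k => (u (n k) x)%:E)).
have mv : measurable_fun setT v.
  apply: measurableT_comp => //; apply: measurable_fun_limn_esup => k.
  exact/measurable_EFinP/(su _).1.
have mB N (w : T -> R) : measurable_fun setT w ->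
    measurable_fun setT (fun x => ((u N x - w x) ^+ 2)%:E).
  by move=> mw; apply/measurable_EFinP/measurable_funX/measurable_funB => //; exact: (su N).1.
have fatou_le N k0 (e : R) : (forall k, (k0 <= k)%N ->
    dotp (fun x => u N x - u (n k) x) (fun x => u N x - u (n k) x) <= e) ->
    (\int[mu]_x (((u N x - v x) ^+ 2)%:E) <= e%:E)%E.
  move=> He.
  have := @fatou _ _ _ mu _ measurableT (fun k x => ((u N x - u (n k) x) ^+ 2)%:E)
    (fun k => mB N _ (su _).1) (fun k x _ => ltac:(by rewrite lee_fin sqr_ge0)).
  have le_e : (limn_einf (fun k => \int[mu]_x ((u N x - u (n k) x) ^+ 2)%:E) <= e%:E)%E.
    apply: (@limn_einf_le _ _ k0) => k /He.
    by rewrite -dotpE ?lee_fin//; exact: sqintB.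
  move=> /le_trans/(_ le_e); apply: le_trans; rewrite le_eqVlt; apply/orP; left; apply/eqP.
  apply: ae_eq_integral => //; first exact: mB.
    under eq_fun do rewrite /limn_einf.
    apply: measurableT_comp => //; apply: measurable_fun_limn_esup => k.
    by apply: measurableT_comp => //; exact: mB (su _).1.
  apply: filterS ae => x cx _.
  have ce : (fun k => (u (n k) x)%:E) @ \oo --> (lim (u (n k) x @[k --> \oo]))%:E.
    by apply: cvg_EFin; [exact: nearW|].
  have -> : v x = lim (u (n k) x @[k --> \oo]) by rewrite /v (cvg_limn_einf_sup ce).2.
  apply/esym; apply: (cvg_limn_einf_sup _).1; apply: cvg_EFin; first exact: nearW.
  rewrite expr2; under eq_fun do rewrite expr2.
  by apply: cvgM; apply: cvgB => //; exact: cvg_cst.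
have sv N : sqint (fun x => u N x - v x) -> sqint v.
  move=> /(sqintB (su N)); congr sqint; apply/funext => x /=; ring.
have nk k : (k <= n k)%N by exact: leq_addr.
have {}sv : sqint v.
  have [K1 K1P] := cu 1 ltr01.
  apply: (sv K1); apply: sqint_fin; first exact: measurable_funB (su _).1 mv.
  apply: le_lt_trans (ltry 1); apply: (@fatou_le K1 K1) => k K1k.
  by apply: K1P => //; exact: leq_trans (nk k).
exists v => //; apply/cvgrPdist_lt => e e0.
have [K1 K1P] := cu (e / 2) ltac:(lra).
exists K1 => // N /= K1N; rewrite sub0r normrN ger0_norm ?dotp_ge0//.
suff : dotp (fun x => u N x - v x) (fun x => u N x - v x) <= e / 2 by lra.
rewrite -lee_fin dotpE; last exact: sqintB.
apply: (@fatou_le N K1) => k K1k.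
by apply: K1P => //; exact: leq_trans (nk k).
Qed.

End square_integrable.

(** * Polynomials in the Koopman operator *)

Section polynomial_operators.
Context {R : realType}.
Implicit Types s : seq (R * nat).

Definition poly_opp s := [seq (- p.1, p.2) | p <- s].

Definition poly_mulX s := [seq (p.1, p.2.+1) | p <- s].

Definition mass s := \sum_(p <- s) `|p.1|.

Lemma mass_cat s1 s2 : mass (s1 ++ s2) = mass s1 + mass s2.
Proof. exact: big_cat. Qed.

Lemma mass_opp s : mass (poly_opp s) = mass s.
Proof. by rewrite /mass big_map; apply: eq_bigr => p _ /=; rewrite normrN. Qed.

Lemma mass_mulX s : mass (poly_mulX s) = mass s.
Proof. by rewrite /mass big_map. Qed.

Lemma trig_re_cat s1 s2 t : trig_re (s1 ++ s2) t = trig_re s1 t + trig_re s2 t.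
Proof. exact: big_cat. Qed.

Lemma trig_im_cat s1 s2 t : trig_im (s1 ++ s2) t = trig_im s1 t + trig_im s2 t.
Proof. exact: big_cat. Qed.

Lemma trig_re_opp s t : trig_re (poly_opp s) t = - trig_re s t.
Proof. by rewrite /trig_re big_map -sumrN; apply: eq_bigr => p _ /=; rewrite mulNr. Qed.

Lemma trig_im_opp s t : trig_im (poly_opp s) t = - trig_im s t.
Proof. by rewrite /trig_im big_map -sumrN; apply: eq_bigr => p _ /=; rewrite mulNr. Qed.

Lemma trig_re_mulX s t : trig_re (poly_mulX s) t =
  cos (2 * pi * t) * trig_re s t - sin (2 * pi * t) * trig_im s t.
Proof.
rewrite /trig_re /trig_im big_map !mulr_sumr -sumrB; apply: eq_bigr => p _ /=.
by rewrite -[p.2.+1%:R]natr1 mulrDr mulr1 cosD; ring.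
Qed.

Lemma trig_im_mulX s t : trig_im (poly_mulX s) t =
  sin (2 * pi * t) * trig_re s t + cos (2 * pi * t) * trig_im s t.
Proof.
rewrite /trig_re /trig_im big_map !mulr_sumr -big_split; apply: eq_bigr => p _ /=.
by rewrite -[p.2.+1%:R]natr1 mulrDr mulr1 sinD; ring.
Qed.

Section apply_poly.
Variables (T : Type) (tau : T -> T).

Definition poly_apply s (u : T -> R) x := \sum_(p <- s) p.1 * u (iter p.2 tau x).

Lemma poly_apply_cat s1 s2 u x :
  poly_apply (s1 ++ s2) u x = poly_apply s1 u x + poly_apply s2 u x.
Proof. exact: big_cat. Qed.

Lemma poly_apply_opp s u x : poly_apply (poly_opp s) u x = - poly_apply s u x.
Proof. by rewrite /poly_apply big_map -sumrN; apply: eq_bigr => p _ /=; rewrite mulNr. Qed.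

Lemma poly_apply_mulX s u x : poly_apply (poly_mulX s) u x = poly_apply s u (tau x).
Proof. by rewrite /poly_apply big_map; apply: eq_bigr => p _ /=; rewrite -iterSr. Qed.

End apply_poly.

End polynomial_operators.

Section koopman.
Context {d} {T : measurableType d} {R : realType} (mu : probability T R).
Variable tau : T -> T.
Hypothesis mtau : measurable_fun setT tau.
Hypothesis ptau : forall B, measurable B -> mu (tau @^-1` B) = mu B.

Lemma ge0_integral_preserving (f : T -> \bar R) : measurable_fun setT f ->
  (forall x, (0 <= f x)%E) -> (\int[mu]_x f (tau x) = \int[mu]_x f x)%E.
Proof.
move=> mf f0.
have := ge0_integral_pushforward mtau mu measurableT mf (fun x _ => f0 x).
rewrite preimage_setT => <-; apply: eq_measure_integral => A mA _.
exact: ptau.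
Qed.

Lemma sqint_preserving u : sqint mu u -> sqint mu (u \o tau).
Proof.
move=> su; apply: sqint_fin; first exact: measurableT_comp (su.1) mtau.
rewrite /= (@ge0_integral_preserving (fun x => (u x ^+ 2)%:E)).
- by rewrite -dotpE// ltry.
- exact: sqint_measurable_sqr su.
- by move=> x; rewrite lee_fin sqr_ge0.
Qed.

Lemma dotp_preserving_sqr u : sqint mu u -> dotp mu (u \o tau) (u \o tau) = dotp mu u u.
Proof.
move=> su; apply: EFin_inj; rewrite !dotpE//; last exact: sqint_preserving.
apply: (@ge0_integral_preserving (fun x => (u x ^+ 2)%:E)).
- exact: sqint_measurable_sqr su.
- by move=> x; rewrite lee_fin sqr_ge0.
Qed.

Lemma dotp_preserving u v : sqint mu u -> sqint mu v ->
  dotp mu (u \o tau) (v \o tau) = dotp mu u v.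
Proof.
move=> su sv; have su' := sqint_preserving su; have sv' := sqint_preserving sv.
have polar w z : sqint mu w -> sqint mu z -> dotp mu (fun x => w x + z x) (fun x => w x + z x) =
    dotp mu w w + dotp mu z z + 2 * dotp mu w z.
  move=> sw sz; have sD := sqintD sw sz; rewrite dotpDl//.
  rewrite [dotp mu w (fun x => _ + _)]dotpC [dotp mu z (fun x => _ + _)]dotpC !dotpDl//.
  by rewrite [dotp mu z w]dotpC; lra.
have := dotp_preserving_sqr (sqintD su sv); rewrite polar// [in LHS](polar _ _ su' sv').
by rewrite !dotp_preserving_sqr//; lra.
Qed.

Lemma sqint_iter u m : sqint mu u -> sqint mu (fun x => u (iter m tau x)).
Proof.
move=> su; elim: m => [//|m IH].
by under eq_fun do rewrite iterSr; exact: sqint_preserving IH.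
Qed.

Lemma sqint_poly_apply s u : sqint mu u -> sqint mu (poly_apply tau s u).
Proof. by move=> su; apply: sqint_sum => p; exact/sqintZ/sqint_iter. Qed.

Definition correlation u j l := dotp mu (fun x => u (iter j tau x)) (fun x => u (iter l tau x)).

Lemma dotp_poly_apply u s : sqint mu u ->
  dotp mu (poly_apply tau s u) (poly_apply tau s u) = quad_form (correlation u) s.
Proof.
move=> su; have si m := sqint_iter m su.
have sZ (p : R * nat) : sqint mu (fun x => p.1 * u (iter p.2 tau x)) by exact: sqintZ.
rewrite {1}/poly_apply dotp_suml//; last exact: sqint_poly_apply.
apply: eq_bigr => p _; rewrite dotpC dotp_suml//; apply: eq_bigr => q _.
by rewrite dotpZl// dotpC dotpZl// /correlation; ring.
Qed.

Lemma poly_apply_cvg0 u (s : nat -> seq (R * nat)) (C : R) : sqint mu u ->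
  (forall k, mass (s k) <= C) ->
  (forall t, 0 <= t <= 1 -> (fun k => trig_re (s k) t) @ \oo --> 0) ->
  (forall t, 0 <= t <= 1 -> (fun k => trig_im (s k) t) @ \oo --> 0) ->
  (fun k => dotp mu (poly_apply tau (s k) u) (poly_apply tau (s k) u)) @ \oo --> 0.
Proof.
move=> su sC re0 im0; under eq_fun do rewrite dotp_poly_apply//.
have si m := sqint_iter m su.
apply: (quad_form_cvg0 (C := C)) => //.
- by move=> j l; exact: dotpC.
- move=> j l; rewrite /correlation -[RHS]dotp_preserving//.
  by congr dotp; apply/funext => x /=; rewrite -iterSr.
- move=> K c.
  have -> : \sum_(j < K) \sum_(l < K) c j * c l * correlation u j l =
    dotp mu (fun x => \sum_(j < K) c j * u (iter j tau x))
            (fun x => \sum_(j < K) c j * u (iter j tau x)).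
    rewrite dotp_suml; [|by move=> j; exact: sqintZ|by apply: sqint_sum => j; exact: sqintZ].
    apply: eq_bigr => j _; rewrite dotpC dotp_suml; [|by move=> l; exact: sqintZ|exact: sqintZ].
    apply: eq_bigr => l _.
    by rewrite dotpZl//; [rewrite dotpC dotpZl// /correlation; ring|exact: sqintZ].
  exact: dotp_ge0.
Qed.

Theorem poly_apply_cvg u (s : nat -> seq (R * nat)) (C : R) : sqint mu u ->
  (forall N, mass (s N) <= C) ->
  (forall t, 0 <= t <= 1 -> cvgn (fun N => trig_re (s N) t)) ->
  (forall t, 0 <= t <= 1 -> cvgn (fun N => trig_im (s N) t)) ->
  exists2 v, sqint mu v &
    (fun N => dotp mu (fun x => poly_apply tau (s N) u x - v x)
                      (fun x => poly_apply tau (s N) u x - v x)) @ \oo --> 0.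
Proof.
move=> su sC cre cim; apply: sqint_complete; first by move=> N; exact: sqint_poly_apply.
move=> e e0; apply: contrapT => noK.
have /choice[NM NMP] : forall k, exists NM : nat * nat, [/\ (k <= NM.1)%N, (k <= NM.2)%N &
    e < dotp mu (fun x => poly_apply tau (s NM.1) u x - poly_apply tau (s NM.2) u x)
                (fun x => poly_apply tau (s NM.1) u x - poly_apply tau (s NM.2) u x)].
  move=> k; apply: contrapT => noNM; apply: noK; exists k => N M kN kM.
  by rewrite leNgt; apply/negP => eNM; apply: noNM; exists (N, M).
pose r k := s (NM k).1 ++ poly_opp (s (NM k).2).
have sub (f : nat -> nat) : (forall k, (k <= f k)%N) -> f @ \oo --> \oo.
  by move=> kf A [n _ nA]; exists n => // k /= nk; apply: nA; exact: leq_trans (kf k).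
have sub1 : (fun k => (NM k).1) @ \oo --> \oo by apply: sub => k; case: (NMP k).
have sub2 : (fun k => (NM k).2) @ \oo --> \oo by apply: sub => k; case: (NMP k).
have diff0 (f : nat -> R) : cvgn f -> (fun k => f (NM k).1 - f (NM k).2) @ \oo --> 0.
  move=> cf; rewrite -(subrr (limn f)).
  exact: cvgB (cvg_comp _ _ sub1 cf) (cvg_comp _ _ sub2 cf).
have : (fun k => dotp mu (poly_apply tau (r k) u) (poly_apply tau (r k) u)) @ \oo --> 0.
  apply: (poly_apply_cvg0 (C := C + C)) => // [k|t t01|t t01].
  - by rewrite mass_cat mass_opp lerD.
  - rewrite /r; under eq_fun do rewrite trig_re_cat trig_re_opp.
    exact: diff0 (cre t t01).
  - rewrite /r; under eq_fun do rewrite trig_im_cat trig_im_opp.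
    exact: diff0 (cim t t01).
move=> /cvgrPdist_lt/(_ e e0)[k _ /(_ k (leqnn k))] /=.
rewrite sub0r normrN ger0_norm ?dotp_ge0// ltNge => /negP; apply; apply: ltW.
have [_ _] := NMP k; congr (_ < dotp _ _ _); apply/funext => x;
  by rewrite /r poly_apply_cat poly_apply_opp.
Qed.

Lemma dotp_invariant w h : sqint mu w -> sqint mu h ->
  {ae mu, forall x, h (tau x) = h x} -> dotp mu (w \o tau) h = dotp mu w h.
Proof.
move=> sw sh hinv; rewrite -[RHS]dotp_preserving//.
have sh' := sqint_preserving sh; have sw' := sqint_preserving sw.
rewrite /dotp /Rintegral; congr fine; apply: ae_eq_integral => //.
- by apply/measurable_EFinP; exact: measurable_funM sw'.1 sh.1.
- by apply/measurable_EFinP; exact: measurable_funM sw'.1 sh'.1.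
- by apply: filterS hinv => x hx _ /=; rewrite hx.
Qed.

Section limits.
Variables (u v : T -> R) (s : nat -> seq (R * nat)).
Hypotheses (su : sqint mu u) (sv : sqint mu v).
Hypothesis uv : (fun N => dotp mu (fun x => poly_apply tau (s N) u x - v x)
                      (fun x => poly_apply tau (s N) u x - v x)) @ \oo --> 0.

Lemma poly_limit_invariant (C : R) : (forall N, mass (s N) <= C) ->
  (forall t, 0 < t < 1 -> (fun N => trig_re (s N) t) @ \oo --> 0) ->
  (forall t, 0 < t < 1 -> (fun N => trig_im (s N) t) @ \oo --> 0) ->
  {ae mu, forall x, v (tau x) = v x}.
Proof.
move=> sC re0 im0.
pose r N := poly_mulX (s N) ++ poly_opp (s N).
have ends (t : R) : 0 <= t <= 1 -> 0 < t < 1 \/ (cos (2 * pi * t) = 1 /\ sin (2 * pi * t) = 0).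
  move=> /andP[]; rewrite !le_eqVlt => /predU1P[<- _|t0 /predU1P[->|t1]].
  - by right; rewrite mulr0 cos0 sin0.
  - by right; rewrite mulr1 mulr_natl cos2pi sin2pi.
  - by left; rewrite t0.
have rcvg : (fun N => dotp mu (poly_apply tau (r N) u) (poly_apply tau (r N) u)) @ \oo --> 0.
  apply: (poly_apply_cvg0 (C := C + C)) => // [N|t /ends[t01|[ct st]]|t /ends[t01|[ct st]]].
  - by rewrite mass_cat mass_opp mass_mulX lerD.
  - rewrite /r; under eq_fun do rewrite trig_re_cat trig_re_opp trig_re_mulX.
    suff : (fun N => cos (2 * pi * t) * trig_re (s N) t - sin (2 * pi * t) * trig_im (s N) t
              - trig_re (s N) t) @ \oo -->
              (cos (2 * pi * t) * 0 - sin (2 * pi * t) * 0 - 0) by rewrite !mulr0 !subr0.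
    by apply: cvgB (re0 t t01); apply: cvgB; apply: cvgMl_tmp; [exact: re0|exact: im0].
  - rewrite /r; under eq_fun do rewrite trig_re_cat trig_re_opp trig_re_mulX ct st mul1r mul0r subr0 subrr.
    exact: cvg_cst.
  - rewrite /r; under eq_fun do rewrite trig_im_cat trig_im_opp trig_im_mulX.
    suff : (fun N => sin (2 * pi * t) * trig_re (s N) t + cos (2 * pi * t) * trig_im (s N) t
              - trig_im (s N) t) @ \oo -->
              (sin (2 * pi * t) * 0 + cos (2 * pi * t) * 0 - 0) by rewrite !mulr0 subr0 addr0.
    by apply: cvgB (im0 t t01); apply: cvgD; apply: cvgMl_tmp; [exact: re0|exact: im0].
  - rewrite /r; under eq_fun do rewrite trig_im_cat trig_im_opp trig_im_mulX ct st mul1r mul0r add0r subrr.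
    exact: cvg_cst.
pose w x := v (tau x) - v x.
have sw : sqint mu w by apply: sqintB => //; exact: sqint_preserving.
pose D N x := poly_apply tau (s N) u x - v x.
have sD N : sqint mu (D N) by apply: sqintB => //; exact: sqint_poly_apply.
have w_le N : dotp mu w w <= 6 * dotp mu (D N) (D N) +
    4 * dotp mu (poly_apply tau (r N) u) (poly_apply tau (r N) u).
  have sDt := sqint_preserving (sD N).
  have sr := sqint_poly_apply (r N) su.
  have wE : w = fun x => (-1 * (D N \o tau) x) + (poly_apply tau (r N) u x + D N x).
    apply/funext => x /=; rewrite /r poly_apply_cat poly_apply_opp poly_apply_mulX /w /D.
    by ring.
  have := dotp_parallelogram_le (sqintZ (-1) sDt) (sqintD sr (sD N)); rewrite -wE.
  rewrite dotpZl//; last exact: sqintZ.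
  rewrite [dotp mu (_ \o _) (fun x => _ * _)]dotpC dotpZl//.
  rewrite dotp_preserving//.
  have := dotp_parallelogram_le sr (sD N); lra.
have w0 : dotp mu w w <= 6 * 0 + 4 * 0.
  have cv : (fun N => 6 * dotp mu (D N) (D N) +
      4 * dotp mu (poly_apply tau (r N) u) (poly_apply tau (r N) u)) @ \oo --> (6 * 0 + 4 * 0 : R).
    exact: cvgD (cvgMl_tmp uv) (cvgMl_tmp rcvg).
  by apply: cvgr_to_ge cv _; exact: nearW.
apply: filterS (dotp_eq0 sw _) => [x /eqP|]; first by rewrite subr_eq0 => /eqP.
by have := dotp_ge0 mu w; lra.
Qed.

Lemma poly_limit_orthogonal h : (forall N, \sum_(p <- s N) p.1 = 1) ->
  sqint mu h -> {ae mu, forall x, h (tau x) = h x} ->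
  dotp mu (fun x => u x - v x) h = 0.
Proof.
move=> s1 sh hinv.
have si m : sqint mu (fun x => u (iter m tau x)) by exact: sqint_iter.
have iterE m : dotp mu (fun x => u (iter m tau x)) h = dotp mu u h.
  elim: m => [//|m IH]; rewrite -IH -(@dotp_invariant (fun x => u (iter m tau x)))//.
  by congr dotp; apply/funext => x /=; rewrite -iterSr.
have cE N : dotp mu (fun x => poly_apply tau (s N) u x - v x) h =
    dotp mu (fun x => u x - v x) h.
  rewrite !dotpBl//; last exact: sqint_poly_apply.
  congr (_ - _); rewrite dotp_suml//; last by move=> p; exact: sqintZ.
  under eq_bigr do rewrite dotpZl// iterE.
  by rewrite -mulr_suml s1 mul1r.
have := dotp_cvg0 (fun N => sqintB (sqint_poly_apply (s N) su) sv) sh uv.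
under eq_fun do rewrite cE.
by move/cvg_lim => <-//; apply/esym/cvg_lim => //; exact: cvg_cst.
Qed.

End limits.

End koopman.

(** * Complex functions *)

Section complex_numbers.
Context {R : realType}.
Implicit Types (z : R[i]) (t : R).

Lemma ReD z1 z2 : complex.Re (z1 + z2) = complex.Re z1 + complex.Re z2.
Proof. by case: z1 z2 => ? ? []. Qed.

Lemma ImD z1 z2 : complex.Im (z1 + z2) = complex.Im z1 + complex.Im z2.
Proof. by case: z1 z2 => ? ? []. Qed.

Lemma ReB z1 z2 : complex.Re (z1 - z2) = complex.Re z1 - complex.Re z2.
Proof. by case: z1 z2 => ? ? []. Qed.

Lemma ImB z1 z2 : complex.Im (z1 - z2) = complex.Im z1 - complex.Im z2.
Proof. by case: z1 z2 => ? ? []. Qed.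

Lemma Re_realM (a : R) z : complex.Re (a%:C%C * z) = a * complex.Re z.
Proof. by case: z => x y /=; rewrite mul0r subr0. Qed.

Lemma Im_realM (a : R) z : complex.Im (a%:C%C * z) = a * complex.Im z.
Proof. by case: z => x y /=; rewrite mul0r addr0. Qed.

Lemma Re_sum (I : Type) (r : seq I) (F : I -> R[i]) :
  complex.Re (\sum_(i <- r) F i) = \sum_(i <- r) complex.Re (F i).
Proof. exact: (big_morph _ ReD). Qed.

Lemma Im_sum (I : Type) (r : seq I) (F : I -> R[i]) :
  complex.Im (\sum_(i <- r) F i) = \sum_(i <- r) complex.Im (F i).
Proof. exact: (big_morph _ ImD). Qed.

Lemma complex_inj z1 z2 : complex.Re z1 = complex.Re z2 ->
  complex.Im z1 = complex.Im z2 -> z1 = z2.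
Proof. by case: z1 z2 => ? ? [? ?] /= -> ->. Qed.

Lemma conj_complexE z : z^* = (complex.Re z -i* complex.Im z)%C.
Proof. by case: z. Qed.

Lemma Re_norm_sqr z : complex.Re `|z| ^+ 2 = complex.Re z ^+ 2 + complex.Im z ^+ 2.
Proof. by rewrite normc_def /= sqr_sqrtr// addr_ge0 ?sqr_ge0. Qed.

Lemma Re_norm_ge0 z : 0 <= complex.Re `|z|.
Proof. by rewrite normc_def /= sqrtr_ge0. Qed.

Lemma cvg_complexP (z : nat -> R[i]) (l : R[i]) :
  (z : nat -> R[i]^o) @ \oo --> (l : R[i]^o) <->
  (fun k => complex.Re (z k)) @ \oo --> complex.Re l /\
  (fun k => complex.Im (z k)) @ \oo --> complex.Im l.
Proof.
split=> [/cvgrPdist_lt zl|[/cvgrPdist_lt re /cvgrPdist_lt im]].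
  split; apply/cvgrPdist_lt => e e0.
  - have /zl : 0 < e%:C%C :> R[i]^o by rewrite ltcR.
    apply: filterS => k; rewrite normc_def ltcR; apply: le_lt_trans.
    by rewrite ReB -sqrtr_sqr ler_sqrt ?lerDl ?addr_ge0 ?sqr_ge0.
  - have /zl : 0 < e%:C%C :> R[i]^o by rewrite ltcR.
    apply: filterS => k; rewrite normc_def ltcR; apply: le_lt_trans.
    by rewrite ImB -sqrtr_sqr ler_sqrt ?lerDr ?addr_ge0 ?sqr_ge0.
apply/cvgrPdist_lt => e; rewrite ltcE => /andP[/eqP /= e0 e1].
have -> : e = (complex.Re e)%:C%C by apply: complex_inj.
have h0 : 0 < complex.Re e / 2 by lra.
near=> k; rewrite normc_def ltcR ReB ImB.
have rk : `|complex.Re l - complex.Re (z k)| < complex.Re e / 2 by near: k; exact: (re _ h0).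
have ik : `|complex.Im l - complex.Im (z k)| < complex.Re e / 2 by near: k; exact: (im _ h0).
move: rk ik; set a := _ - _; set b := _ - _ => ak bk.
apply: (@le_lt_trans _ _ (`|a| + `|b|)); last by lra.
rewrite -[leRHS]ger0_norm ?addr_ge0// -sqrtr_sqr ler_sqrt ?sqr_ge0//.
rewrite (sqrrD `|a|) !real_normK ?num_real// addrAC lerDl.
by rewrite mulrn_wge0 // mulr_ge0.
Unshelve. all: by end_near.
Qed.

Definition cis t : R[i] := (cos (2 * pi * t) +i* sin (2 * pi * t))%C.

Lemma cisX t m : cis t ^+ m = (cos (2 * pi * t * m%:R) +i* sin (2 * pi * t * m%:R))%C.
Proof.
elim: m => [|m IH]; first by rewrite mulr0 cos0 sin0.
have -> : 2 * pi * t * m.+1%:R = 2 * pi * t + 2 * pi * t * m%:R by rewrite -(natr1 m); ring.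
by rewrite exprS IH cosD sinD; apply: complex_inj => /=; ring.
Qed.

Lemma norm_cis t : `|cis t| = 1.
Proof. by rewrite normc_def /= cos2Dsin2 sqrtr1. Qed.

Lemma cisP z : `|z| = 1 -> exists2 t, 0 <= t < 1 & z = cis t.
Proof.
move=> z1; have : complex.Re z ^+ 2 + complex.Im z ^+ 2 = 1.
  by rewrite -Re_norm_sqr z1 /= expr1n.
case: z {z1} => x y /= xy.
have x2 : -1 <= x <= 1.
  rewrite -ler_norml -(@ler_sqr _ `|x| 1) ?nnegrE// expr1n real_normK ?num_real//.
  by have := sqr_ge0 y; lra.
have [/andP[a0 api] cosa] := acos_def x2.
have p0 := pi_gt0 R.
have sina : sin (acos x) = `|y|.
  rewrite sin_acos// -[RHS]ger0_norm// -sqrtr_sqr real_normK ?num_real//.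
  by congr Num.sqrt; lra.
have [y0|y0] := leP 0 y.
  exists (acos x / (2 * pi)).
    by rewrite divr_ge0 ?mulr_ge0//=; [rewrite ltr_pdivrMr; lra|lra].
  rewrite /cis; have -> : 2 * pi * (acos x / (2 * pi)) = acos x by field; lra.
  by rewrite cosa sina ger0_norm.
have a1 : 0 < acos x.
  rewrite lt_neqAle a0 andbT; apply/eqP => e.
  by move: sina; rewrite -e sin0 => /esym/eqP; rewrite normr_eq0 lt_eqF.
exists (1 - acos x / (2 * pi)).
  have -> : 1 - acos x / (2 * pi) = (2 * pi - acos x) / (2 * pi) by field; lra.
  rewrite divr_ge0 ?ltr_pdivrMr/=; lra.
rewrite /cis.
have -> : 2 * pi * (1 - acos x / (2 * pi)) = - acos x + pi *+ 2.
  by rewrite -[pi *+ 2]mulr_natl; field; lra.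
by rewrite cosD2pi sinD2pi cosN sinN cosa sina ltr0_norm// opprK.
Qed.

End complex_numbers.

Section ip_averages.
Context {R : realType} (n : nat -> nat).
Implicit Types (A : {fset nat}) (a : nat -> R[i]).

Definition ip_poly A : seq (R * nat) :=
  [seq ((2 ^+ #|` A|)^-1, (\sum_(j <- F) n j)%N) | F : {fset nat} <- fpowerset A].

Lemma ip_poly_sum A : \sum_(p <- ip_poly A) p.1 = 1.
Proof.
rewrite big_map big_const_seq count_predT iter_addr_0 -[X in X = _]mulr_natl.
by rewrite -[size _]/(#|` fpowerset A|) card_fpowerset natrX mulfV// expf_neq0.
Qed.

Lemma mass_ip_poly A : mass (ip_poly A) = 1.
Proof.
rewrite -(ip_poly_sum A) /mass !big_map; apply: eq_bigr => F _ /=.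
by rewrite ger0_norm// invr_ge0 exprn_ge0.
Qed.

Lemma ip_avgE A a : ip_avg n A a = \sum_(p <- ip_poly A) (p.1)%:C%C * a p.2.
Proof.
rewrite /ip_avg big_map mulr_sumr; apply: eq_bigr => F _ /=.
by rewrite fmorphV rmorphXn rmorph_nat.
Qed.

Lemma Re_ip_avg A a :
  complex.Re (ip_avg n A a) = \sum_(p <- ip_poly A) p.1 * complex.Re (a p.2).
Proof. by rewrite ip_avgE Re_sum; apply: eq_bigr => p _; rewrite Re_realM. Qed.

Lemma Im_ip_avg A a :
  complex.Im (ip_avg n A a) = \sum_(p <- ip_poly A) p.1 * complex.Im (a p.2).
Proof. by rewrite ip_avgE Im_sum; apply: eq_bigr => p _; rewrite Im_realM. Qed.

Lemma Re_ip_avg_cis A t :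
  complex.Re (ip_avg n A (fun m => cis t ^+ m)) = trig_re (ip_poly A) t.
Proof. by rewrite Re_ip_avg; apply: eq_bigr => p _; rewrite cisX. Qed.

Lemma Im_ip_avg_cis A t :
  complex.Im (ip_avg n A (fun m => cis t ^+ m)) = trig_im (ip_poly A) t.
Proof. by rewrite Im_ip_avg; apply: eq_bigr => p _; rewrite cisX. Qed.

Lemma ip_avgM A a (z : R[i]) : ip_avg n A (fun m => a m * z) = ip_avg n A a * z.
Proof. by rewrite /ip_avg -mulrA mulr_suml. Qed.

End ip_averages.

Section complex_L2.
Context {R : realType} {X : pmetricType R}.
Variable mu : probability (borel X) R.
Implicit Types (f g : X -> R[i]) (F : nat -> X -> R[i]).

Local Notation re f := ((fun x => complex.Re (f x)) : borel X -> R).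
Local Notation im f := ((fun x => complex.Im (f x)) : borel X -> R).

Lemma L2normE f :
  L2norm mu f = sqrte (\int[mu]_x ((re f x ^+ 2 + im f x ^+ 2)%:E)).
Proof.
rewrite /L2norm unlock -poweR12_sqrt; last first.
  by apply: integral_ge0 => x _; rewrite lee_fin addr_ge0 ?sqr_ge0.
congr (_ `^ _)%E; apply: eq_integral => x _.
rewrite gee0_abs ?lee_fin ?Re_norm_ge0// poweR_EFin powR_mulrn ?Re_norm_ge0//.
by rewrite Re_norm_sqr.
Qed.

Lemma integral_sqr_add f : sqint mu (re f) -> sqint mu (im f) ->
  (\int[mu]_x ((re f x ^+ 2 + im f x ^+ 2)%:E) =
   (dotp mu (re f) (re f) + dotp mu (im f) (im f))%:E)%E.
Proof.
move=> sr si; under eq_integral do rewrite EFinD.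
rewrite ge0_integralD ?EFinD ?dotpE//; by [exact: (sqint_measurable_sqr sr)|exact: (sqint_measurable_sqr si)|move=> x _; rewrite lee_fin sqr_ge0].
Qed.

Lemma L2P f : L2 mu f <-> sqint mu (re f) /\ sqint mu (im f).
Proof.
split=> [[mr mi]|[sr si]]; last first.
  by split; [exact: sr.1|exact: si.1|rewrite L2normE integral_sqr_add//= ltry].
rewrite L2normE -poweR12_sqrt; last first.
  by apply: integral_ge0 => x _; rewrite lee_fin addr_ge0 ?sqr_ge0.
have half : 2^-1 != 0 :> R by rewrite invr_eq0 pnatr_eq0.
move=> /(lty_poweRy half) fi.
have mD : measurable_fun setT (fun x : borel X => (re f x ^+ 2 + im f x ^+ 2)%:E).
  by apply/measurable_EFinP/measurable_funD; exact: measurable_funX.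
split; apply: sqint_fin => //; apply: le_lt_trans fi; apply: ge0_le_integral => //.
- by move=> x _; rewrite lee_fin sqr_ge0.
- exact/measurable_EFinP/measurable_funX.
- by move=> x _; rewrite lee_fin lerDl sqr_ge0.
- by move=> x _; rewrite lee_fin sqr_ge0.
- exact/measurable_EFinP/measurable_funX.
- by move=> x _; rewrite lee_fin lerDr sqr_ge0.
Qed.

Lemma L2_cvgP F g : (forall N, L2 mu (F N)) -> L2 mu g ->
  L2_cvg mu F g <->
  (fun N => dotp mu (fun x => re (F N) x - re g x) (fun x => re (F N) x - re g x)) @ \oo --> 0 /\
  (fun N => dotp mu (fun x => im (F N) x - im g x) (fun x => im (F N) x - im g x)) @ \oo --> 0.
Proof.
move=> LF Lg.
pose a N := dotp mu (fun x => re (F N) x - re g x) (fun x => re (F N) x - re g x).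
pose b N := dotp mu (fun x => im (F N) x - im g x) (fun x => im (F N) x - im g x).
have a0 N : 0 <= a N by exact: dotp_ge0.
have b0 N : 0 <= b N by exact: dotp_ge0.
have nE : (fun N => L2norm mu (fun x => F N x - g x)) = EFin \o (fun N => Num.sqrt (a N + b N)).
  apply/funext => N /=.
  have [sr si] := (L2P _).1 (LF N); have [gr gi] := (L2P _).1 Lg.
  have E1 : re (fun x => F N x - g x) = fun x => re (F N) x - re g x.
    by apply/funext => x; exact: ReB.
  have E2 : im (fun x => F N x - g x) = fun x => im (F N) x - im g x.
    by apply/funext => x; exact: ImB.
  by rewrite L2normE integral_sqr_add ?E1 ?E2//=; exact: sqintB.
rewrite /L2_cvg nE; split=> [/fine_cvgP[_ sq]|[ca cb]].
  have {}sq : (fun N => Num.sqrt (a N + b N)) @ \oo --> (0 : R) by exact: sq.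
  have ab : (fun N => a N + b N) @ \oo --> (0 : R).
    have -> : (fun N => a N + b N) = fun N => Num.sqrt (a N + b N) * Num.sqrt (a N + b N).
      by apply/funext => N; rewrite -expr2 sqr_sqrtr ?addr_ge0.
    by suff : (fun N => Num.sqrt (a N + b N) * Num.sqrt (a N + b N)) @ \oo --> (0 * 0 : R);
      [rewrite mulr0|exact: cvgM].
  split; apply: squeeze_cvgr (cvg_cst 0) ab; apply: nearW => N; rewrite -/(a N) -/(b N).
  - by rewrite a0 lerDl b0.
  - by rewrite b0 lerDr a0.
apply: cvg_EFin; first exact: nearW.
have ab : (fun N => a N + b N) @ \oo --> (0 : R) 
  by suff : (fun N => a N + b N) @ \oo --> (0 + 0 : R); [rewrite addr0|exact: cvgD].
rewrite -(@sqrtr0 R); exact: continuous_cvg (@sqrt_continuous R 0) ab.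
Qed.

Lemma L2_innerE f g : L2 mu f -> L2 mu g -> L2_inner mu f g =
  ((dotp mu (re f) (re g) + dotp mu (im f) (im g)) +i*
   (dotp mu (im f) (re g) - dotp mu (re f) (im g)))%C.
Proof.
move=> /L2P[fr fi] /L2P[gr gi]; rewrite /L2_inner /dotp.
rewrite -RintegralD//; [|exact: sqint_mul..].
rewrite -RintegralB//; [|exact: sqint_mul..].
congr (_ +i* _)%C; apply: eq_Rintegral => x _; rewrite conj_complexE.
- by case: (f x) => a b; case: (g x) => c d /=; ring.
- by case: (f x) => a b; case: (g x) => c d /=; ring.
Qed.

Lemma L2Z (z : R[i]) f : L2 mu f -> L2 mu (fun x => z * f x).
Proof.
move=> /L2P[sr si]; apply/L2P; split.
- have -> : re (fun x => z * f x) = fun x => complex.Re z * re f x - complex.Im z * im f x.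
    by apply/funext => x; case: z (f x) => ? ? [].
  by apply: sqintB; exact: sqintZ.
- have -> : im (fun x => z * f x) = fun x => complex.Re z * im f x + complex.Im z * re f x.
    by apply/funext => x; case: z (f x) => ? ? [].
  by apply: sqintD; exact: sqintZ.
Qed.

Lemma L2_cvg_coefficient f g (z : nat -> R[i]) : L2 mu f -> L2 mu g ->
  L2_inner mu f f = 1 -> L2_cvg mu (fun N x => z N * f x) g ->
  (z : nat -> R[i]^o) @ \oo --> (L2_inner mu g f : R[i]^o).
Proof.
move=> Lf Lg f1 cv.
have Lz N : L2 mu (fun x => z N * f x) by exact: L2Z.
have [fr fi] := (L2P _).1 Lf; have [gr gi] := (L2P _).1 Lg.
have [cr ci] := (L2_cvgP Lz Lg).1 cv.
have sr N : sqint mu (fun x => re (fun x => z N * f x) x - re g x).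
  by apply: sqintB => //; exact: ((L2P _).1 (Lz N)).1.
have si N : sqint mu (fun x => im (fun x => z N * f x) x - im g x).
  by apply: sqintB => //; exact: ((L2P _).1 (Lz N)).2.
have ff : dotp mu (re f) (re f) + dotp mu (im f) (im f) = 1.
  by have := congr1 (@complex.Re R) f1; rewrite L2_innerE.
have Er N h : sqint mu h -> dotp mu (fun x => re (fun x => z N * f x) x - re g x) h =
    complex.Re (z N) * dotp mu (re f) h - complex.Im (z N) * dotp mu (im f) h - dotp mu (re g) h.
  move=> sh; have -> : (fun x => re (fun x => z N * f x) x - re g x) =
      fun x => (complex.Re (z N) * re f x - complex.Im (z N) * im f x) - re g x.
    by apply/funext => x; case: (z N) (f x) => ? ? [].
  by rewrite !dotpBl ?dotpZl//; repeat (apply: sqintB || apply: sqintZ).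
have Ei N h : sqint mu h -> dotp mu (fun x => im (fun x => z N * f x) x - im g x) h =
    complex.Re (z N) * dotp mu (im f) h + complex.Im (z N) * dotp mu (re f) h - dotp mu (im g) h.
  move=> sh; have -> : (fun x => im (fun x => z N * f x) x - im g x) =
      fun x => (complex.Re (z N) * im f x + complex.Im (z N) * re f x) - im g x.
    by apply/funext => x; case: (z N) (f x) => ? ? [].
  by rewrite dotpBl ?dotpDl ?dotpZl//; repeat (apply: sqintD || apply: sqintZ).
have rr := dotp_cvg0 sr fr cr; have ri := dotp_cvg0 sr fi cr.
have ir := dotp_cvg0 si fr ci; have ii := dotp_cvg0 si fi ci.
apply/cvg_complexP; rewrite L2_innerE//=; split.
- set c := (X in _ --> X).
  pose F N := (dotp mu (fun x => re (fun x => z N * f x) x - re g x) (re f) +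
            dotp mu (fun x => im (fun x => z N * f x) x - im g x) (im f)) + c.
  have -> : (fun k => complex.Re (z k)) = F.
    apply/funext => N; rewrite /F Er// Ei// [dotp mu (im f) (re f)]dotpC /c.
    by rewrite -[LHS]mulr1 -ff; ring.
  suff : F @ \oo --> (0 + 0 + c : R) by rewrite addr0 add0r.
  by apply: cvgD; [exact: cvgD|exact: cvg_cst].
- set c := (X in _ --> X).
  pose F N := (dotp mu (fun x => im (fun x => z N * f x) x - im g x) (re f) -
            dotp mu (fun x => re (fun x => z N * f x) x - re g x) (im f)) + c.
  have -> : (fun k => complex.Im (z k)) = F.
    apply/funext => N; rewrite /F Er// Ei// [dotp mu (im f) (re f)]dotpC /c.
    by rewrite -[LHS]mulr1 -ff; ring.
  suff : F @ \oo --> (0 - 0 + c : R) by rewrite subr0 add0r.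
  by apply: cvgD; [exact: cvgB|exact: cvg_cst].
Qed.

End complex_L2.

Lemma cis_neq1 (R : realType) (t : R) : 0 < t < 1 -> cis t != 1.
Proof.
move=> t01; apply/eqP => /(congr1 (@complex.Re R)) /= ct.
have s0 : 0 < sin (pi * t) by apply: sin_gt0_pi; rewrite mulr_gt0 ?gtr_pMr ?pi_gt0//; lra.
have := cos2Dsin2 (pi * t); move: ct.
have -> : 2 * pi * t = (pi * t) *+ 2 by rewrite -[RHS]mulr_natl mulrA.
by rewrite cos_mulr2n; have := mulr_gt0 s0 s0; rewrite -expr2; lra.
Qed.

Section mean_ergodic.
Context {R : realType} {X : pmetricType R}.
Variables (mu : probability (borel X) R) (T : X -> X).
Variables (n : nat -> nat) (Phi : nat -> {fset nat}).
Hypothesis TP : invertible_mps mu T.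
Implicit Types f g : X -> R[i].

Local Notation re f := ((fun x => complex.Re (f x)) : borel X -> R).
Local Notation im f := ((fun x => complex.Im (f x)) : borel X -> R).
Local Notation s := (fun N => ip_poly n (Phi N) : seq (R * nat)).
Local Notation avg f N := (fun x => ip_avg n (Phi N) (fun m => f (iter m T x))).

Let mT : measurable_fun [set: borel X] (T : borel X -> borel X).
Proof. by case: TP => _ _ []. Qed.

Let pT (B : set (borel X)) : measurable B -> mu (T @^-1` B) = mu B.
Proof. by case: TP => _ _ [_ +] _; exact. Qed.

Lemma L2_ip_avg f N : L2 mu f -> L2 mu (avg f N).
Proof.
move=> /L2P[sr si]; apply/L2P; split.
- under eq_fun do rewrite Re_ip_avg.
  exact: (sqint_poly_apply mT pT (ip_poly n (Phi N)) sr).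
- under eq_fun do rewrite Im_ip_avg.
  exact: (sqint_poly_apply mT pT (ip_poly n (Phi N)) si).
Qed.

Lemma ip_avg_L2_cvg f (vr vi : borel X -> R) : L2 mu f -> sqint mu vr -> sqint mu vi ->
  (fun N => dotp mu (fun x => poly_apply T (s N) (re f) x - vr x)
                    (fun x => poly_apply T (s N) (re f) x - vr x)) @ \oo --> 0 ->
  (fun N => dotp mu (fun x => poly_apply T (s N) (im f) x - vi x)
                    (fun x => poly_apply T (s N) (im f) x - vi x)) @ \oo --> 0 ->
  L2 mu (fun x => (vr x +i* vi x)%C) /\
  L2_cvg mu (fun N => avg f N) (fun x => (vr x +i* vi x)%C).
Proof.
move=> Lf sr si cr ci.
have Lv : L2 mu (fun x => (vr x +i* vi x)%C) by apply/L2P.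
split => //; apply/L2_cvgP => // [N|]; first exact: L2_ip_avg.
by split; under eq_fun do under eq_fun do rewrite ?Re_ip_avg ?Im_ip_avg.
Qed.

Lemma mean_cvg f : L2 mu f ->
  (forall alpha : R[i], `|alpha| = 1 ->
    cvgn (fun N : nat => ip_avg n (Phi N) (fun m => alpha ^+ m) : R[i]^o)) ->
  exists2 v : (borel X -> R) * (borel X -> R), sqint mu v.1 /\ sqint mu v.2 &
  (fun N => dotp mu (fun x => poly_apply T (s N) (re f) x - v.1 x)
                    (fun x => poly_apply T (s N) (re f) x - v.1 x)) @ \oo --> 0 /\
  (fun N => dotp mu (fun x => poly_apply T (s N) (im f) x - v.2 x)
                    (fun x => poly_apply T (s N) (im f) x - v.2 x)) @ \oo --> 0.
Proof.
move=> /L2P[sr si] calpha.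
have ct t : cvgn (fun N => trig_re (s N) t) /\ cvgn (fun N => trig_im (s N) t).
  have /cvg_ex[l /cvg_complexP[cr ci]] := calpha (cis t) (norm_cis t).
  split; apply/cvg_ex.
  - by exists (complex.Re l); move: cr; under eq_fun do rewrite Re_ip_avg_cis.
  - by exists (complex.Im l); move: ci; under eq_fun do rewrite Im_ip_avg_cis.
have s1 N : mass (s N) <= 1 by rewrite mass_ip_poly.
have [vr svr cr] := poly_apply_cvg mT pT sr s1 (fun t _ => (ct t).1) (fun t _ => (ct t).2).
have [vi svi ci] := poly_apply_cvg mT pT si s1 (fun t _ => (ct t).1) (fun t _ => (ct t).2).
by exists (vr, vi).
Qed.

Theorem mean_ergodic_cvg f : L2 mu f ->
  (forall alpha : R[i], `|alpha| = 1 ->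
    cvgn (fun N : nat => ip_avg n (Phi N) (fun m => alpha ^+ m) : R[i]^o)) ->
  exists g, L2 mu g /\ L2_cvg mu (fun N => avg f N) g.
Proof.
move=> Lf calpha; have [[vr vi] /= [svr svi] [cr ci]] := mean_cvg Lf calpha.
by exists (fun x => (vr x +i* vi x)%C); exact: ip_avg_L2_cvg.
Qed.

Theorem mean_ergodic_projection f : L2 mu f ->
  (forall alpha : R[i], `|alpha| = 1 ->
    (fun N : nat => ip_avg n (Phi N) (fun m => alpha ^+ m) : R[i]^o) @ \oo
      --> ((alpha == 1)%:R : R[i]^o)) ->
  exists g, invariant_projection mu T f g /\ L2_cvg mu (fun N => avg f N) g.
Proof.
move=> Lf calpha; have [fr fi] := (L2P _ _).1 Lf.
have [|[vr vi] /= [svr svi] [cr ci]] := mean_cvg Lf.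
  by move=> alpha alpha1; apply/cvg_ex; exists ((alpha == 1)%:R); exact: calpha.
have [Lv cv] := ip_avg_L2_cvg Lf svr svi cr ci.
have c0 t : 0 < t < 1 -> (fun N => trig_re (s N) t) @ \oo --> 0 /\
                         (fun N => trig_im (s N) t) @ \oo --> 0.
  move=> t01; have /cvg_complexP := calpha (cis t) (norm_cis t).
  rewrite (negPf (cis_neq1 t01)) => -[].
  by under eq_fun do rewrite Re_ip_avg_cis; under [in X in _ -> X]eq_fun do rewrite Im_ip_avg_cis.
have s1 N : mass (s N) <= 1 by rewrite mass_ip_poly.
have inv_r := poly_limit_invariant mT pT fr svr cr s1 (fun t t01 => (c0 t t01).1) (fun t t01 => (c0 t t01).2).
have inv_i := poly_limit_invariant mT pT fi svi ci s1 (fun t t01 => (c0 t t01).1) (fun t t01 => (c0 t t01).2).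
exists (fun x => (vr x +i* vi x)%C); split => //; split.
  split => //; apply: filterS2 inv_r inv_i => x.
  by rewrite /= => -> ->.
move=> h [Lh hinv]; have [hr hi] := (L2P _ _).1 Lh.
have hr_inv : {ae mu, forall x, re h (T x) = re h x} 
  by case: hinv => N [mN N0 sub]; exists N; split => // x /= hx; apply: sub => /= e; apply: hx; rewrite e.
have hi_inv : {ae mu, forall x, im h (T x) = im h x} 
  by case: hinv => N [mN N0 sub]; exists N; split => // x /= hx; apply: sub => /= e; apply: hx; rewrite e.
have s1E N : \sum_(p <- s N) p.1 = 1 by exact: ip_poly_sum.
have E1 : re (fun x => f x - (vr x +i* vi x)%C) = fun x => re f x - vr x.
  by apply/funext => x; exact: ReB.
have E2 : im (fun x => f x - (vr x +i* vi x)%C) = fun x => im f x - vi x.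
  by apply/funext => x; exact: ImB.
rewrite L2_innerE//; last by apply/L2P; rewrite E1 E2; split; exact: sqintB.
rewrite E1 E2.
rewrite (poly_limit_orthogonal mT pT fr svr cr s1E hr hr_inv).
rewrite (poly_limit_orthogonal mT pT fr svr cr s1E hi hi_inv).
rewrite (poly_limit_orthogonal mT pT fi svi ci s1E hr hr_inv).
rewrite (poly_limit_orthogonal mT pT fi svi ci s1E hi hi_inv).
by rewrite addr0 subr0.
Qed.

End mean_ergodic.

(** * Rotations *)

(* The circle is modelled by [0, 1] with Lebesgue measure on [0, 1[, which makes
   the space compact without a quotient; rotations fix the null point 1. *)
Definition unit_interval (R : realType) : Type := set_type (`[0, 1]%classic : set R).

Section unit_interval_instances.
Context {R : realType}.

HB.instance Definition _ := PseudoMetric.copy (unit_interval R)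
  (set_type (`[0, 1]%classic : set R)).

Definition ival (x : unit_interval R) : R := set_val x.

Lemma ival_itv x : 0 <= ival x <= 1.
Proof. by have := set_valP x; rewrite /= in_itv. Qed.

Lemma clamp_subproof (x : R) : Num.max 0 (Num.min x 1) \in (`[0, 1]%classic : set R).
Proof. by rewrite inE/= in_itv/= le_max lexx/= ge_max ler01 ge_min lexx orbT. Qed.

Definition clamp (x : R) : unit_interval R := SigSub (clamp_subproof x).

HB.instance Definition _ := isPointed.Build (unit_interval R) (clamp 0).

Lemma ival_inj : injective ival.
Proof. exact: val_inj. Qed.

Let dist (x y : unit_interval R) : R := `|ival x - ival y|.

Let dist_ge0 x y : 0 <= dist x y. Proof. exact: normr_ge0. Qed.

Let dist_eq0 x y : dist x y = 0 -> x = y.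
Proof. by move=> /eqP; rewrite normr_eq0 subr_eq0 => /eqP/ival_inj. Qed.

Let ball_dist (x : unit_interval R) d : ball x d = [set y | dist x y < d].
Proof. by []. Qed.

HB.instance Definition _ := PseudoMetric_isMetric.Build R (unit_interval R)
  dist_ge0 dist_eq0 ball_dist.

End unit_interval_instances.

Section circle_measure.
Context {R : realType}.
Local Notation I := (unit_interval R).

Lemma ival_clamp (x : R) : 0 <= x <= 1 -> ival (clamp x) = x.
Proof.
move=> /andP[x0 x1]; have -> : ival (clamp x) = Num.max 0 (Num.min x 1) by [].
by rewrite (min_idPl x1) (max_idPr x0).
Qed.

Lemma clampK (x : I) : clamp (ival x) = x.
Proof. by apply: ival_inj; rewrite ival_clamp// ival_itv. Qed.

Lemma continuous_ival : continuous (@ival R).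
Proof. exact: initial_continuous. Qed.

Lemma continuous_clamp : continuous (@clamp R).
Proof.
apply: continuous_comp_initial => x.
apply: (@continuous_max R R (cst 0) (fun x => Num.min x 1)); first exact: cvg_cst.
by apply: (@continuous_min R R id (cst 1)); [exact: cvg_id|exact: cvg_cst].
Qed.

Lemma compact_unit_interval : compact [set: I].
Proof.
have -> : [set: I] = clamp @` `[0, 1]%classic.
  apply/seteqP; split => // x _; exists (ival x); last exact: clampK.
  by rewrite /= in_itv/= ival_itv.
apply: continuous_compact (@segment_compact R 0 1).
exact/continuous_subspaceT/continuous_clamp.
Qed.

Lemma measurable_clamp : measurable_fun [set: measurableTypeR R] (@clamp R : _ -> borel I).
Proof.
apply: (@measurability _ _ _ (borel I) setT _ (@open I) erefl) => // _ [U oU <-]; rewrite setTI.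
by apply: open_measurable; move/continuousP : continuous_clamp; exact.
Qed.

Lemma measurable_ival : measurable_fun [set: borel I] (@ival R : borel I -> R).
Proof.
apply: (measurability _ (RGenOpens.measurableE R)) => // _ [_ [a [b ->] <-]]; rewrite setTI.
apply: sub_sigma_algebra; move/continuousP : continuous_ival; apply.
exact: interval_open.
Qed.

Definition lebesgue01 := mrestr (@lebesgue_measure R) (@measurable_itv R `[0, 1[).

HB.instance Definition _ := Measure.on lebesgue01.

Let lebesgue01_setT : lebesgue01 setT = 1%E.
Proof.
by rewrite /lebesgue01 /mrestr setTI lebesgue_measure_itv/= lte_fin ltr01 oppr0 adde0.
Qed.

HB.instance Definition _ := Measure_isProbability.Build _ _ _ lebesgue01 lebesgue01_setT.

HB.instance Definition _ := isMeasurableFun.Build _ _ _ _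
  (@clamp R : measurableTypeR R -> borel I) measurable_clamp.

Definition circle_measure : probability (borel I) R :=
  distribution lebesgue01 (@clamp R : measurableTypeR R -> borel I).

Lemma circle_measureE (B : set (borel I)) :
  circle_measure B = lebesgue_measure (clamp @^-1` B `&` `[0, 1[%classic : set R).
Proof. by []. Qed.

Lemma measurable_circle_preimage (B : set (borel I)) : measurable B ->
  measurable (clamp @^-1` B : set (measurableTypeR R)).
Proof. by move=> mB; rewrite -[X in measurable X]setTI; exact: measurable_clamp. Qed.

Lemma circle_measure_lt_pinfty (B : set (borel I)) : measurable B -> (circle_measure B < +oo)%E.
Proof. by move=> mB; apply: le_lt_trans (probability_le1 _ mB) _; exact: ltry. Qed.

Lemma lebesgue_le_setD (D E : set (measurableTypeR R)) : measurable D -> measurable E ->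
  (lebesgue_measure E <= lebesgue_measure D + lebesgue_measure (E `\` D))%E.
Proof.
move=> mD mE; have mED : measurable (E `\` D) by exact: measurableD.
apply: le_trans (measureU2 _ mD mED); apply: le_measure; rewrite ?inE//.
  exact: measurableU.
by move=> x Ex; have [Dx|nDx] := pselect (D x); [left|right].
Qed.

Lemma circle_measure_outer (B : set (borel I)) : measurable B ->
  circle_measure B = ereal_inf [set circle_measure U | U in [set U : set I | open U /\ B `<=` U]].
Proof.
move=> mB; apply/eqP; rewrite eq_le; apply/andP; split.
  apply: le_ereal_inf_tmp => _ [U [oU BU] <-]; apply: le_measure; rewrite ?inE//.
  exact: sub_sigma_algebra.
apply/lee_addgt0Pr => e e0.
have mD' := measurableI _ _ (measurable_circle_preimage mB) (@measurable_itv R `[0, 1[).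
have mD := measurableI _ _ (measurable_circle_preimage mB) (@measurable_itv R `[0, 1]).
set D := (X in measurable X) in mD; set D' := (X in measurable X) in mD'.
have DD' : (lebesgue_measure D <= circle_measure B)%E.
  apply: le_trans (lebesgue_le_setD mD' mD) _.
  suff -> : lebesgue_measure (D `\` D') = 0%E by rewrite adde0.
  apply/eqP; rewrite eq_le measure_ge0 andbT -(lebesgue_measure_set1 (1 : R)).
  apply: le_measure; rewrite ?inE//; first exact: measurableD.
  move=> x [[Bx x01] nD]; apply: contrapT => x1; apply: nD; split => //.
  move: x01; rewrite /= !in_itv/= => /andP[-> x1'] /=.
  by rewrite lt_neqAle x1' andbT; apply/eqP.
have [|U [oU DU UD]] := lebesgue_regularity_outer mD _ e0.
  exact: le_lt_trans DD' (circle_measure_lt_pinfty mB).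
apply: (@le_trans _ _ (circle_measure (ival @^-1` U))).
  apply: ereal_inf_lbound; exists (ival @^-1` U) => //; split.
    by move/continuousP : continuous_ival; apply.
  by move=> x Bx; apply: DU; split; rewrite /= ?clampK// in_itv/= ival_itv.
have mU : measurable (U : set (measurableTypeR R)) by exact: open_measurable.
apply: (@le_trans _ _ (lebesgue_measure U)).
  rewrite circle_measureE; apply: le_measure; rewrite ?inE//.
    apply: measurableI => //; apply: measurable_circle_preimage.
    by apply: sub_sigma_algebra; move/continuousP : continuous_ival; apply.
  move=> x [] /= Ux; rewrite in_itv/= => /andP[x0 /ltW x1].
  by move: Ux; rewrite ival_clamp// x0.
apply: le_trans (lebesgue_le_setD mD mU) _.
by apply: leeD => //; exact: ltW.
Qed.

Lemma circle_measure_inner (B : set (borel I)) : measurable B ->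
  circle_measure B = ereal_sup [set circle_measure K | K in [set K : set I | compact K /\ K `<=` B]].
Proof.
have mcompact (K : set I) : compact K -> measurable (K : set (borel I)).
  move=> cK; rewrite -[K]setCK; apply: measurableC; apply: sub_sigma_algebra.
  by apply: closed_openC; apply: compact_closed cK; exact: metric_hausdorff.
move=> mB; apply/eqP; rewrite eq_le; apply/andP; split; last first.
  apply: ge_ereal_sup => _ [K [cK KB] <-]; apply: le_measure; rewrite ?inE//.
  exact: mcompact.
apply/lee_addgt0Pr => e e0.
have mD := measurableI _ _ (measurable_circle_preimage mB) (@measurable_itv R `[0, 1[).
set D := (X in measurable X) in mD.
have [|V [cV VD DV]] := lebesgue_regularity_inner mD _ e0.
  exact: circle_measure_lt_pinfty mB.
have mV : measurable (V : set (measurableTypeR R)) by exact: compact_measurable.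
apply: le_trans (lebesgue_le_setD mV mD) _.
apply: leeD; last exact: ltW.
have cK : compact (clamp @` V : set I).
  by apply: continuous_compact cV; exact/continuous_subspaceT/continuous_clamp.
apply: (@le_trans _ _ (circle_measure (clamp @` V))).
  rewrite circle_measureE; apply: le_measure; rewrite ?inE//.
    by apply: measurableI => //; apply: measurable_circle_preimage; exact: mcompact.
  by move=> x Vx; split; [exists x|exact: (VD _ Vx).2].
apply: ereal_sup_ubound; exists (clamp @` V) => //; split => // _ [x Vx <-].
exact: (VD _ Vx).1.
Qed.

Lemma circle_measure_regular : regular_measure circle_measure.
Proof. by move=> B mB; split; [exact: circle_measure_outer|exact: circle_measure_inner]. Qed.

End circle_measure.

Section rotation.
Context {R : realType}.
Local Notation I := (unit_interval R).

Definition rotation_real (theta y : R) : R :=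
  if y < 1 then if y + theta < 1 then y + theta else y + theta - 1 else y.

Definition rotation (theta : R) (x : I) : I := clamp (rotation_real theta (ival x)).

Lemma rotation_real_itv (theta y : R) : 0 <= theta <= 1 -> 0 <= y <= 1 ->
  0 <= rotation_real theta y <= 1.
Proof.
move=> t01 y01; rewrite /rotation_real; case: ltP => ?; last by [].
by case: ltP => ?; apply/andP; split; lra.
Qed.

Lemma rotationK (theta : R) : 0 <= theta <= 1 ->
  cancel (rotation theta) (rotation (1 - theta)).
Proof.
move=> t01 x; apply: ival_inj; have x01 := ival_itv x.
have r01 := rotation_real_itv t01 x01.
rewrite /rotation (ival_clamp r01) ival_clamp; last by apply: rotation_real_itv => //; lra.
rewrite /rotation_real; case: (ltP (ival x) 1) => x1; last by rewrite ltNge x1.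
have [y1|y1] := ltP (ival x + theta) 1.
  by rewrite y1; have -> : ival x + theta + (1 - theta) < 1 = false; [apply/negbTE; rewrite -leNgt|]; lra.
have -> : ival x + theta - 1 < 1 by lra.
by have -> : ival x + theta - 1 + (1 - theta) < 1; lra.
Qed.

Lemma measurable_rotation_real (theta : R) :
  measurable_fun [set: measurableTypeR R] (rotation_real theta).
Proof.
have mD (c : R) : measurable_fun [set: measurableTypeR R] (fun y : R => y + c).
  by apply: measurable_funD.
apply: measurable_fun_ifT => //; first exact: measurable_fun_ltr.
apply: measurable_fun_ifT => //; first exact: measurable_fun_ltr.
by under eq_fun do rewrite -addrA; exact: mD.
Qed.

Lemma measurable_rotation (theta : R) :
  measurable_fun [set: borel I] (rotation theta : borel I -> borel I).
Proof.
apply: (measurableT_comp measurable_clamp).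
exact: (measurableT_comp (measurable_rotation_real theta) measurable_ival).
Qed.

Lemma lebesgue_measure_translation (c : R) (A : set (measurableTypeR R)) : measurable A ->
  lebesgue_measure ((fun y : R => y + c) @^-1` A) = lebesgue_measure A.
Proof.
have mD : measurable_fun [set: measurableTypeR R] (fun y : R => y + c : measurableTypeR R).
  by apply: measurable_funD.
move=> mA; apply/esym.
apply: (@lebesgue_measure_unique R (pushforward lebesgue_measure (fun y : R => y + c : measurableTypeR R)) _ _ mA).
move=> _ [[a b]] _ <-; rewrite /pushforward/=.
rewrite [X in _ = lebesgue_measure X](_ : _ = `]a - c, b - c]%classic); last first.
  by apply/seteqP; split => y /=; rewrite !in_itv/= ltrBlDr lerBrDr.
rewrite !lebesgue_measure_itv/= !lte_fin ltrD2r; case: ifPn => // _.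
by rewrite -!EFinB; congr (_%:E); ring.
Qed.

Lemma rotation_preserving (theta : R) : 0 <= theta <= 1 ->
  forall B : set (borel I), measurable B ->
  circle_measure (rotation theta @^-1` B) = circle_measure B.
Proof.
move=> t01 B mB; rewrite !circle_measureE.
set D : set (measurableTypeR R) := clamp @^-1` B.
have mD : measurable D by exact: measurable_circle_preimage.
have -> : (clamp @^-1` (rotation theta @^-1` B)) `&` `[0, 1[%classic =
    ((fun y : R => y + theta) @^-1` (D `&` `[theta, 1[%classic)) `|`
    ((fun y : R => y + (theta - 1)) @^-1` (D `&` `[0, theta[%classic)).
  apply/seteqP; split => [y [] /= + y01|y].
    have y01' : 0 <= y <= 1 by move: y01; rewrite in_itv/=; lra.
    rewrite /rotation ival_clamp// /rotation_real.
    move: y01; rewrite in_itv/= => /andP[y0 y1]; rewrite y1.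
    case: ltP => yt By; [left|right]; rewrite /D/= in_itv/= ?addrA; split => //; lra.
  move=> [] [] /= Dy; rewrite in_itv/= => yt.
    have y01' : 0 <= y <= 1 by lra.
    have y1 : y < 1 by lra.
    split; last by rewrite in_itv/= y1; lra.
    rewrite /rotation ival_clamp// /rotation_real y1.
    by have -> : y + theta < 1 by lra.
  have y01' : 0 <= y <= 1 by lra.
  have y1 : y < 1 by lra.
  split; last by rewrite in_itv/= y1; lra.
  rewrite /rotation ival_clamp// /rotation_real y1.
  have -> : y + theta < 1 = false by apply/negbTE; rewrite -leNgt; lra.
  by rewrite -addrA.
have mDt : measurable (D `&` `[theta, 1[%classic) by exact: measurableI.
have mDt' : measurable (D `&` `[0, theta[%classic) by exact: measurableI.
have mpre (c : R) (E : set (measurableTypeR R)) : measurable E ->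
    measurable ((fun y : R => y + c) @^-1` E : set (measurableTypeR R)).
  have mD' : measurable_fun [set: measurableTypeR R] (fun y : R => y + c : measurableTypeR R).
    by apply: measurable_funD.
  by move=> mE; rewrite -[X in measurable X]setTI; exact: mD'.
rewrite measureU; [|exact: mpre|exact: mpre|]; last first.
  apply/seteqP; split => y //= [[_] /=]; rewrite in_itv/= => yt [_] /=.
  by rewrite in_itv/=; lra.
transitivity (lebesgue_measure (D `&` `[theta, 1%R[%classic) +
              lebesgue_measure (D `&` `[0%R, theta[%classic))%E.
  by congr (_ + _)%E; exact: lebesgue_measure_translation.
rewrite -measureU//; last first.
  by apply/seteqP; split => y //= [[_] /=]; rewrite in_itv/= => yt [_] /=; rewrite in_itv/=; lra.
congr (lebesgue_measure _); apply/seteqP; split => [y [] [] Dy|y [Dy]] /=;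
  rewrite !in_itv/= => yt.
- by split => //; lra.
- by split => //; lra.
- by have [yth|yth] := leP theta y; [left|right]; split => //=; rewrite ?in_itv/=; lra.
Qed.

Lemma rotation_mps (theta : R) : 0 <= theta <= 1 ->
  invertible_mps (circle_measure : probability (borel I) R) (rotation theta).
Proof.
move=> t01; split.
- exact: compact_unit_interval.
- exact: circle_measure_regular.
- by split; [exact: measurable_rotation|exact: rotation_preserving].
- exists (rotation (1 - theta)); split.
  + exact: rotationK.
  + by rewrite -{2}[theta](subKr 1); apply: rotationK; lra.
  + exact: measurable_rotation.
Qed.

End rotation.

Section eigenfunction.
Context {R : realType}.
Local Notation I := (unit_interval R).
Local Notation mu := (circle_measure : probability (borel I) R).

(* e^(2 pi i x) on [0, 1[, and 0 at the fixed point 1 of the rotations. *)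
Definition character (x : I) : R[i] := if ival x < 1 then cis (ival x) else 0.

Local Notation re f := ((fun x => complex.Re (f x)) : borel I -> R).
Local Notation im f := ((fun x => complex.Im (f x)) : borel I -> R).

Lemma cisD (s t : R) : cis (s + t) = cis s * cis t.
Proof.
by rewrite /cis mulrDr cosD sinD; apply: complex_inj => //=; rewrite addrC.
Qed.

Lemma cisB1 (t : R) : cis (t - 1) = cis t.
Proof.
rewrite -[in RHS](subrK 1 t) [RHS]cisD.
have -> : cis (1 : R) = 1 by rewrite /cis mulr1 mulr_natl cos2pi sin2pi.
by rewrite mulr1.
Qed.

Lemma character_rotation (t : R) x : 0 <= t < 1 ->
  character (rotation t x) = cis t * character x.
Proof.
move=> t01; have x01 := ival_itv x.
rewrite /character /rotation ival_clamp; last by apply: rotation_real_itv => //; lra.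
rewrite /rotation_real; case: (ltP (ival x) 1) => x1; last by rewrite ltNge x1 mulr0.
have [y1|y1] := ltP (ival x + t) 1; first by rewrite y1 addrC cisD.
have -> : ival x + t - 1 < 1 by lra.
by rewrite cisB1 addrC cisD.
Qed.

Lemma character_iter (t : R) x m : 0 <= t < 1 ->
  character (iter m (rotation t) x) = cis t ^+ m * character x.
Proof.
move=> t01; elim: m => [|m IH]; first by rewrite mul1r.
by rewrite iterS character_rotation// IH mulrA -exprS.
Qed.

Lemma character_sqr_ae :
  {ae mu, forall x, (re character x ^+ 2 + im character x ^+ 2 = 1)}.
Proof.
exists (~` (ival @^-1` `]-oo, 1[%classic)); split.
- apply: measurableC; rewrite -[X in measurable X]setTI.
  exact: measurable_ival.
- apply/eqP; rewrite circle_measureE eq_le measure_ge0 andbT.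
  rewrite [X in lebesgue_measure X](_ : _ = set0) ?measure0//.
  apply/seteqP; split => // x [] /= + x01; apply.
  by move: x01; rewrite !in_itv/= => /andP[x0 x1]; rewrite ival_clamp// x0 ltW.
- move=> x; apply: contra_not => /=; rewrite in_itv/= /character => ->.
  exact: cos2Dsin2.
Qed.

Lemma measurable_Re_character : measurable_fun [set: borel I] (re character).
Proof.
have -> : re character = fun x => if ival x < 1 then cos (2 * pi * ival x) else 0.
  by apply/funext => x; rewrite /character; case: ifP.
apply: measurable_fun_ifT => //; first exact: measurable_fun_ltr measurable_ival _.
apply: (measurableT_comp (continuous_measurable_fun (@continuous_cos R))).
exact: measurable_funM (measurable_cst _) measurable_ival.
Qed.

Lemma measurable_Im_character : measurable_fun [set: borel I] (im character).
Proof.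
have -> : im character = fun x => if ival x < 1 then sin (2 * pi * ival x) else 0.
  by apply/funext => x; rewrite /character; case: ifP.
apply: measurable_fun_ifT => //; first exact: measurable_fun_ltr measurable_ival _.
apply: (measurableT_comp (continuous_measurable_fun (@continuous_sin R))).
exact: measurable_funM (measurable_cst _) measurable_ival.
Qed.

Lemma integral_character_sqr :
  (\int[mu]_x ((re character x ^+ 2 + im character x ^+ 2)%:E) = 1)%E.
Proof.
transitivity (\int[mu]_x (cst 1%E x))%E; last first.
  by rewrite integral_cst// mul1e; exact: probability_setT.
apply: ae_eq_integral => //.
  apply/measurable_EFinP; apply: measurable_funD; apply: measurable_funX.
    exact: measurable_Re_character.
  exact: measurable_Im_character.
by apply: filterS character_sqr_ae => x xE _; rewrite xE.
Qed.

Lemma L2_character : L2 mu character.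
Proof.
split; [exact: measurable_Re_character|exact: measurable_Im_character|].
by rewrite L2normE integral_character_sqr /= ltry.
Qed.

Lemma L2_inner_character : L2_inner mu character character = 1.
Proof.
have [sr si] := (L2P _ _).1 L2_character.
rewrite L2_innerE//; try exact: L2_character.
have := integral_character_sqr; rewrite integral_sqr_add// => -[->].
by rewrite [dotp _ (im character) _]dotpC subrr.
Qed.

End eigenfunction.

Section eigenfunction_projection.
Context {R : realType} {X : pmetricType R}.
Variables (mu : probability (borel X) R) (T : X -> X).
Hypothesis TP : invertible_mps mu T.

Lemma eigenfunction_invariant_orthogonal (f g : X -> R[i]) (alpha : R[i]) :
  L2 mu f -> (forall x, f (T x) = alpha * f x) -> alpha != 1 ->
  L2_invariant mu T g -> L2_inner mu g f = 0.
Proof.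
move=> Lf fT alpha1 [Lg ginv].
have mT : measurable_fun [set: borel X] (T : borel X -> borel X) by case: TP => _ _ [].
have pT (B : set (borel X)) : measurable B -> mu (T @^-1` B) = mu B.
  by case: TP => _ _ [_ +] _; exact.
have [fr fi] := (L2P _ _).1 Lf; have [gr gi] := (L2P _ _).1 Lg.
pose a := complex.Re alpha; pose b := complex.Im alpha.
have ab : (a - 1) ^+ 2 + b ^+ 2 != 0.
  rewrite paddr_eq0 ?sqr_ge0// !sqrf_eq0 subr_eq0; apply/negP => /andP[/eqP a1 /eqP b0].
  by move/eqP: alpha1; apply; apply: complex_inj.
have orth (h : borel X -> R) : sqint mu h -> {ae mu, forall x, h (T x) = h x} ->
    dotp mu (fun x : borel X => complex.Re (f x)) h = 0 /\
    dotp mu (fun x : borel X => complex.Im (f x)) h = 0.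
  move=> sh hinv.
  have := dotp_invariant mT pT fr sh hinv; have := dotp_invariant mT pT fi sh hinv.
  have -> : (fun x : borel X => complex.Re (f x)) \o T =
      fun x => a * complex.Re (f x) - b * complex.Im (f x).
    by apply/funext => x /=; rewrite fT /a /b; case: alpha {alpha1 fT a b ab} (f x) => ? ? [].
  have -> : (fun x : borel X => complex.Im (f x)) \o T =
      fun x => a * complex.Im (f x) + b * complex.Re (f x).
    by apply/funext => x /=; rewrite fT /a /b; case: alpha {alpha1 fT a b ab} (f x) => ? ? [].
  rewrite dotpDl ?dotpBl ?dotpZl//; try exact: sqintZ.
  set q1 := dotp mu (fun x : borel X => complex.Re (f x)) h.
  set q2 := dotp mu (fun x : borel X => complex.Im (f x)) h => e2 e1.
  have h1 : ((a - 1) ^+ 2 + b ^+ 2) * q1 = 0.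
    transitivity ((a - 1) * (a * q1 - b * q2 - q1) + b * (a * q2 + b * q1 - q2)); first by ring.
    by rewrite e1 e2 !subrr !mulr0 addr0.
  have h2 : ((a - 1) ^+ 2 + b ^+ 2) * q2 = 0.
    transitivity ((a - 1) * (a * q2 + b * q1 - q2) - b * (a * q1 - b * q2 - q1)); first by ring.
    by rewrite e1 e2 !subrr !mulr0 subr0.
  by move/eqP: h1; move/eqP: h2; rewrite !mulf_eq0 (negPf ab)/= => /eqP -> /eqP ->.
have ginv_r : {ae mu, forall x, complex.Re (g (T x)) = complex.Re (g x)}.
  by case: ginv => N [mN N0 sub]; exists N; split => // x /= hx; apply: sub => /= e; apply: hx; rewrite e.
have ginv_i : {ae mu, forall x, complex.Im (g (T x)) = complex.Im (g x)}.
  by case: ginv => N [mN N0 sub]; exists N; split => // x /= hx; apply: sub => /= e; apply: hx; rewrite e.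
have [rr ir] := orth _ gr ginv_r; have [ri ii] := orth _ gi ginv_i.
rewrite L2_innerE// ![dotp mu (fun x => _ (g x)) _]dotpC rr ir ri ii.
by rewrite addr0 subr0.
Qed.

End eigenfunction_projection.

Section circle_coefficients.
Context {R : realType} (n : nat -> nat) (Phi : nat -> {fset nat}).
Local Notation mu := (circle_measure : probability (borel (unit_interval R)) R).

Lemma circle_avg_coefficient (t : R) (g : unit_interval R -> R[i]) : 0 <= t < 1 ->
  L2 mu g ->
  L2_cvg mu (fun N x => ip_avg n (Phi N) (fun m => character (iter m (rotation t) x))) g ->
  (fun N => ip_avg n (Phi N) (fun m => cis t ^+ m) : R[i]^o) @ \oo -->
    (L2_inner mu g character : R[i]^o).
Proof.
move=> t01 Lg cv; apply: (L2_cvg_coefficient L2_character Lg L2_inner_character).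
move: cv; congr L2_cvg; apply/funext => N; apply/funext => x.
by rewrite -ip_avgM; congr ip_avg; apply/funext => m; rewrite character_iter.
Qed.

Lemma ip_avg1 A : ip_avg n A (fun m => 1 ^+ m) = 1 :> R[i].
Proof.
under eq_fun do rewrite expr1n.
apply: complex_inj; rewrite ?Re_ip_avg ?Im_ip_avg /=.
- by under eq_bigr do rewrite mulr1; exact: ip_poly_sum.
- by under eq_bigr do rewrite mulr0; rewrite big1.
Qed.

End circle_coefficients.

Theorem theorem3p1 (R : realType) (n : nat -> nat) (Phi : nat -> {fset nat})
    (n_gt0 : forall j, (0 < j)%N -> (0 < n j)%N) (PhiF : folner R Phi) :
  ((forall (X : pmetricType R) (mu : probability (borel X) R) (T : X -> X),
      invertible_mps mu T -> forall f : X -> R[i], L2 mu f ->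
      exists g : X -> R[i], L2 mu g /\
        L2_cvg mu
          (fun N x => ip_avg n (Phi N) (fun m => f (iter m T x))) g)
   <->
   (forall alpha : R[i], `|alpha| = 1 ->
      cvgn (fun N : nat => ip_avg n (Phi N) (fun m => alpha ^+ m) : R[i]^o)))
  /\
  ((forall (X : pmetricType R) (mu : probability (borel X) R) (T : X -> X),
      invertible_mps mu T -> forall f : X -> R[i], L2 mu f ->
      exists g : X -> R[i], invariant_projection mu T f g /\
        L2_cvg mu
          (fun N x => ip_avg n (Phi N) (fun m => f (iter m T x))) g)
   <->
   (forall alpha : R[i], `|alpha| = 1 ->
      (fun N : nat => ip_avg n (Phi N) (fun m => alpha ^+ m) : R[i]^o) @ \oo
        --> ((alpha == 1)%:R : R[i]^o))).

Proof.
have itvW (t : R) : 0 <= t < 1 -> 0 <= t <= 1 by move=> /andP[-> /ltW].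
split; split.
- move=> avg_cvg alpha /cisP[t t01 ->].
  have [g [Lg cv]] := avg_cvg _ _ _ (rotation_mps (itvW t t01)) _ L2_character.
  exact: cvgP (circle_avg_coefficient t01 Lg cv).
- by move=> cvg_alpha X mu T TP f Lf; exact: mean_ergodic_cvg.
- move=> avg_cvg alpha /cisP[t t01 ->].
  have [e1|alpha1] := eqVneq (cis t) 1.
    by rewrite e1; under eq_fun do rewrite ip_avg1; exact: cvg_cst.
  have TP := rotation_mps (itvW t t01).
  have [g [[ginv _] cv]] := avg_cvg _ _ _ TP _ L2_character.
  have := circle_avg_coefficient t01 ginv.1 cv.
  rewrite (eigenfunction_invariant_orthogonal TP L2_character _ alpha1 ginv)//.
  by move=> x; exact: character_rotation.
- by move=> cvg_alpha X mu T TP f Lf; exact: mean_ergodic_projection.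
Qed.
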